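(* Let $F\in\mathbb{D}^{1,2}$. Then for every $t>0$, $$\nabla P_tF=e^{-t}P_t^{\otimes2}\nabla F .$$
   Context: Setting. Inner products are linear in the first variable. On the full Fock space $\mathbb{C}\Omega\oplus\bigoplus_{n\ge1}L^2(\mathbb{R}_+)^{\otimes n}$ (complex $L^2$, $\|\Omega\|=1$), let $l(h)$ be the left creation operator, $l(h)\Omega=h$, $l(h)(g_1\otimes\cdots\otimes g_n)=h\otimes g_1\otimes\cdots\otimes g_n$, and for real-valued $h\in L^2_{\mathbb{R}}(\mathbb{R}_+)$ let $S(h)=l(h)+l(h)^*$. $\mathcal{SC}$ is the von Neumann algebra generated by $\{S(h):h\in L^2_{\mathbb{R}}(\mathbb{R}_+)\}$ and $\tau(X)=\langle X\Omega,\Omega\rangle$ its faithful normal tracial state; $L^2(\mathcal{SC})$ has inner product $\langle X,Y\rangle=\tau(Y^*X)$. $\mathcal{SC}_{alg}$ is the unital $*$-algebra generated by the $S(h)$, $h\in L^2_{\mathbb{R}}(\mathbb{R}_+)$. Wigner integrals. The map $X\mapsto X\Omega$ extends to a unitary from $L^2(\mathcal{SC})$ onto the Fock space. For $f\in L^2(\mathbb{R}_+^n)\cong L^2(\mathbb{R}_+)^{\otimes n}$, $I_n(f)$ is the element of $L^2(\mathcal{SC})$ corresponding to $f$ (and $I_0(c)=c1$). Every $F\in L^2(\mathcal{SC})$ has a unique expansion $F=\sum_{n\ge0}I_n(f_n)$. Malliavin derivative. $\mathcal{B}_2=L^2(\mathbb{R}_+;L^2(\mathcal{SC}\otimes\mathcal{SC}^{op},\tau\otimes\tau^{op}))$.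 $\nabla:\mathcal{SC}_{alg}\to\mathcal{B}_2$, $A\mapsto(\nabla_sA)_{s\ge0}$, is the linear map with $\nabla_sS(h)=h(s)\,1\otimes1$ and $\nabla_s(AB)=A\cdot\nabla_sB+\nabla_sA\cdot B$, where $A\cdot(x\otimes y)\cdot B=Ax\otimes yB$. It is closable from $L^2(\mathcal{SC})$ to $\mathcal{B}_2$; its closure is still denoted $\nabla$, with domain $\mathbb{D}^{1,2}$, the completion of $\mathcal{SC}_{alg}$ for $\|F\|_{1,2}^2=\|F\|_2^2+\|\nabla F\|_{\mathcal{B}_2}^2$. Free Ornstein-Uhlenbeck semigroup: $P_t\big(\sum_nI_n(f_n)\big)=\sum_ne^{-nt}I_n(f_n)$ on $L^2(\mathcal{SC})$, $t\ge0$; $P_t^{\otimes2}=P_t\otimes P_t$ acts on $\mathcal{B}_2$ pointwise in the time variable. *)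

(* Defs.v *)
(* Scalars are [R[i]] with [R : realType]; every inner
   product is linear in the first variable. *)
From HB Require Import structures.
From mathcomp Require Import all_boot all_order all_algebra.
From mathcomp Require Import complex.
From mathcomp Require Import all_classical all_reals all_analysis.

Set Implicit Arguments.
Unset Strict Implicit.
Unset Printing Implicit Defensive.
Import Order.TTheory GRing.Theory Num.Theory.
Import numFieldNormedType.Exports.

Local Open Scope classical_set_scope.
Local Open Scope ring_scope.
Local Open Scope complex_scope.

Record hilbert (R : realType) := Hilbert {
  hilbert_car :> completeNormedModType R[i];
  inner : hilbert_car -> hilbert_car -> R[i];
  inner_linear : forall z, scalar (inner^~ z);
  inner_conj : forall x y, inner y x = (inner x y)^*;
  inner_norm : forall x, inner x x = `|x| ^+ 2 }.

Section HilbertNotions.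
Variables (R : realType).
Implicit Types H K : hilbert R.

Definition bounded_op H K (T : H -> K) : Prop := linear T /\ continuous T.

Definition linspan H (A : set H) : set H :=
  [set x | exists (n : nat) (c : 'I_n -> R[i]) (v : 'I_n -> H),
     (forall i, A (v i)) /\ x = \sum_i c i *: v i].

Definition total_set H (A : set H) : Prop := closure (linspan A) = setT.

Definition adj H (T : H -> H) : H -> H :=
  get [set T' : H -> H | forall x y, inner (T x) y = inner x (T' y)].

Definition commutant H (A : set (H -> H)) : set (H -> H) :=
  [set T | bounded_op T /\ forall S, A S -> T \o S = S \o T].

End HilbertNotions.

(* [tens_car] with [tmul] is the Hilbert tensor product of [H] and [K]: the two
   fields determine it up to a unique unitary, and imply that [tmul] is
   bilinear. *)
Record hilbert_tensor (R : realType) (H K : hilbert R) := HilbertTensor {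
  tens_car :> hilbert R;
  tmul : H -> K -> tens_car;
  inner_tmul : forall x y x' y',
    inner (tmul x y) (tmul x' y') = inner x x' * inner y y';
  total_tmul : total_set [set z | exists x y, z = tmul x y] }.

Definition tensor_op (R : realType) (H K : hilbert R) (HK : hilbert_tensor H K)
    (A : H -> H) (B : K -> K) : HK -> HK :=
  get [set Q : HK -> HK | bounded_op Q /\
         forall x y, Q (tmul HK x y) = tmul HK (A x) (B y)].

Section HalfLine.
Variable R : realType.

Lemma measurable_half_line : measurable (`[0, +oo[ : set (measurableTypeR R)).
Proof. exact: measurable_itv. Qed.

(* Lebesgue measure on the half-line, as a measure on [R] that ignores the
   negative numbers: functions on the half-line are functions on [R] whose
   values at negative times are irrelevant. *)
Definition lebesgue_half : {measure set (measurableTypeR R) -> \bar R} :=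
  mrestr (@lebesgue_measure R) measurable_half_line.

Definition is_L2 (h : R -> R[i]) : Prop :=
  (fun s => complex.Re (h s)) \in Lfun lebesgue_half 2%:E /\
  (fun s => complex.Im (h s)) \in Lfun lebesgue_half 2%:E.

Record L2half := L2Half { L2half_fun :> R -> R[i]; L2halfP : is_L2 L2half_fun }.

Definition L2half_real (h : L2half) : Prop := forall s, complex.Im (h s) = 0.

Definition inner_L2half (h g : L2half) : R[i] :=
  (\int[lebesgue_half]_s complex.Re (h s * (g s)^*))%R +i*
  (\int[lebesgue_half]_s complex.Im (h s * (g s)^*))%R.

End HalfLine.

(* The full Fock space over L^2 of the half-line, with
   [etens [:: g_1; ..; g_n]] the elementary tensor of the g_i and [etens [::]]
   the vacuum.  The inner products of the elementary tensors (0 across different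
   degrees, product of the inner products in the same degree) and their totality
   determine it up to a unique unitary. *)
Record full_fock (R : realType) := FullFock {
  fock_car :> hilbert R;
  etens : seq (L2half R) -> fock_car;
  inner_etens : forall s s' : seq (L2half R),
    inner (etens s) (etens s') =
      if size s == size s' then
        \prod_(p <- zip s s') inner_L2half p.1 p.2
      else 0;
  total_etens : total_set [set x | exists s, x = etens s] }.

Section Semicircular.
Variables (R : realType) (Fk : full_fock R).

Definition vacuum : Fk := etens Fk [::].

(* The summand of degree [n] of the full Fock space. *)
Definition fock_degree (n : nat) : set Fk :=
  closure (linspan [set x | exists s, size s = n /\ x = etens Fk s]).

Definition creation (h : L2half R) : Fk -> Fk :=
  get [set T : Fk -> Fk | bounded_op T /\
         forall s, T (etens Fk s) = etens Fk (h :: s)].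

Definition field_op (h : L2half R) : Fk -> Fk :=
  creation h \+ adj (creation h).

(* The von Neumann algebra generated by the self-adjoint operators
   [field_op h], [h] real, as a bicommutant. *)
Definition SC : set (Fk -> Fk) :=
  commutant (commutant [set T | exists2 h, L2half_real h & T = field_op h]).

Definition tau (X : Fk -> Fk) : R[i] := inner (X vacuum) vacuum.

End Semicircular.

(* L^2(SC): the completion of SC for <X, Y> = tau (Y^* X).  The values of
   [L2incl] outside SC are irrelevant. *)
Record L2_SC (R : realType) (Fk : full_fock R) := L2SC {
  L2SC_car :> hilbert R;
  L2incl : (Fk -> Fk) -> L2SC_car;
  inner_L2incl : forall X Y, SC X -> SC Y ->
    inner (L2incl X) (L2incl Y) = tau (adj Y \o X);
  dense_L2incl : closure (L2incl @` @SC R Fk) = setT }.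

Section Malliavin.
Variables (R : realType) (Fk : full_fock R) (L : L2_SC Fk).

Definition wigner_unitary : L -> Fk :=
  get [set U : L -> Fk | [/\ bounded_op U,
         (forall x y, inner (U x) (U y) = inner x y),
         (forall y, exists x, U x = y) &
         forall X, SC X -> U (L2incl L X) = X (vacuum Fk)]].

(* The Wigner integral I_n(f), for [f] in [fock_degree n]. *)
Definition wigner (f : Fk) : L := get [set F | wigner_unitary F = f].

(* The unique [f_n] of degree [n] such that F = \sum_n I_n(f_n). *)
Definition chaos (F : L) : nat -> Fk :=
  get [set f : nat -> Fk | (forall n, fock_degree n (f n)) /\
         series (fun n => wigner (f n)) @ \oo --> F].

Definition OU (t : R) (F : L) : L :=
  lim (series (fun n => (expR (- (n%:R * t)))%:C *: wigner (chaos F n)) @ \oo).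

(* A formal sum of terms [(h, x, y)], standing for the sum of the
   s |-> h(s) x (x) y. *)
Definition formal_grad := seq (L2half R * (Fk -> Fk) * (Fk -> Fk)).

(* The graph of the derivative on the unital *-algebra generated by the
   [field_op h], [h] real (self-adjoint, so that words in them suffice).  The
   gradient lies in the algebraic tensor product, where A.(x (x) y).B is
   (A x) (x) (y B).  The rule for the identity is the consequence of Leibniz'
   rule for 1 = 1 * 1. *)
Inductive grad_alg : (Fk -> Fk) -> formal_grad -> Prop :=
| grad_one : grad_alg idfun [::]
| grad_field h : L2half_real h ->
    grad_alg (field_op h) [:: (h, idfun, idfun)]
| grad_scale (c : R[i]) A a : grad_alg A a ->
    grad_alg (fun x => c *: A x)
      [seq (u.1.1, (fun x => c *: u.1.2 x), u.2) | u <- a]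
| grad_add A a B b : grad_alg A a -> grad_alg B b ->
    grad_alg (A \+ B) (a ++ b)
| grad_mul A a B b : grad_alg A a -> grad_alg B b ->
    grad_alg (A \o B)
      ([seq (u.1.1, A \o u.1.2, u.2) | u <- b] ++
       [seq (u.1.1, u.1.2, u.2 \o B) | u <- a]).

(* L^2(SC (x) SC^op, tau (x) tau^op) is L^2(SC) (x) L^2(SC^op), and
   L^2(SC^op) = L^2(SC) as Hilbert spaces because tau is a trace. *)
Variable LL : hilbert_tensor L L.

Definition grad_eval (a : formal_grad) (s : R) : LL :=
  \sum_(u <- a) u.1.1 s *: tmul LL (L2incl L u.1.2) (L2incl L u.2).

Definition simple_fun (G : R -> LL) : Prop :=
  finite_set (range G) /\ forall v, measurable (G @^-1` [set v]).

Definition strongly_measurable (G : R -> LL) : Prop :=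
  exists2 g : nat -> R -> LL, (forall k, simple_fun (g k)) &
    forall s, g k s @[k --> \oo] --> G s.

Definition sqnormB2 (G : R -> LL) : \bar R :=
  (\int[@lebesgue_half R]_s ((complex.Re `|G s|) ^+ 2)%:E)%E.

(* Elements of B_2 are represented by functions, up to equality almost
   everywhere on the half-line. *)
Definition is_B2 (G : R -> LL) : Prop :=
  strongly_measurable G /\ (sqnormB2 G < +oo)%E.

Definition grad_closure (F : L) (G : R -> LL) : Prop :=
  is_B2 G /\
  exists (A : nat -> Fk -> Fk) (a : nat -> formal_grad),
    [/\ (forall k, grad_alg (A k) (a k)),
        L2incl L (A k) @[k --> \oo] --> F &
        sqnormB2 (fun s => grad_eval (a k) s - G s) @[k --> \oo] --> 0%E].

Definition D12 : set L := [set F | exists G, grad_closure F G].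

Definition nabla (F : L) : R -> LL := get [set G | grad_closure F G].

End Malliavin.

(* Main.v *)
(** The Wick words, with vacuum vectors the elementary tensors of real functions,
   span the polynomial algebra, and the gradient of the word of h_1, ..., h_n is
   the sum over k of h_k (s) W(h_1, ..., h_(k-1)) (x) W(h_(k+1), ..., h_n).  Its
   terms have total degree n - 1, so that on the algebra nabla P_t and
   e^(-t) P_t (x) P_t nabla coincide; contractivity of P_t and of its tensor
   square carries the identity over to the closure.

   That the closure is single-valued almost everywhere is closability: the part
   of bidegree (p, q) of the gradient of A keeps one term of that sum for each
   word of length p + q + 1, and is therefore an isometric image of the chaos of
   order p + q + 1 of A.  So if A_k tends to 0 and its gradients converge, every
   bidegree part of the limit vanishes. *)

(* The objects of the statement are picked by choice from their specifications, so each
   specification has first to be shown inhabited. Adjoints come from Riesz representation; most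
   other operators come from bounded extension off a total family, where a bound on finite
   combinations is all that has to be checked. [grad_alg] is a relation: one operator may carry many
   formal gradients. Hence commutation is proved for the graph [grad_closure], and only its almost
   everywhere uniqueness turns this into a statement on [nabla]; the same uniqueness contains the
   well-definedness of the gradient on the algebra. Both facts rest on one representation: the
   vector of an algebra element and its gradient are written with the same list of coefficients and
   Wick words, so that questions of degree become questions about lists. The projection to a
   bidegree cannot be dispensed with in closability: the norm of the whole gradient on the chaos of
   order n is sqrt(n) times the norm of the element, so it has no bound by that norm alone. *)
Require Import Defs.
From HB Require Import structures.
From mathcomp Require Import all_boot all_order all_algebra.
From mathcomp Require Import complex.
From mathcomp Require Import all_classical all_reals all_analysis.
From mathcomp Require Import measurable_realfun ring lra.
Import Order.TTheory GRing.Theory Num.Theory.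
Import numFieldNormedType.Exports.
Import HBSimple.
Local Open Scope classical_set_scope.
Local Open Scope ring_scope.
Local Open Scope complex_scope.
Set Implicit Arguments.
Unset Strict Implicit.
Unset Printing Implicit Defensive.

(** * Hilbert spaces: finite combinations, density, extension *)

Section Hilbert.
Variable R : realType.
Implicit Types H K : hilbert R.

(** Norms take values in [R[i]], whose order is only partial; all estimates are made with this real
    copy. *)
Definition nrm H (x : H) : R := complex.Re `|x|.

Lemma nrmE H (x : H) : `|x| = (nrm x)%:C.
Proof. by rewrite /nrm RRe_real ?normr_real. Qed.

Lemma nrm_ge0 H (x : H) : 0 <= nrm x.
Proof. by rewrite -(@lecR R) -nrmE normr_ge0. Qed.

Lemma nrmD H (x y : H) : nrm (x + y) <= nrm x + nrm y.
Proof. by rewrite -(@lecR R) rmorphD/= -!nrmE ler_normD. Qed.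

Lemma nrmN H (x : H) : nrm (- x) = nrm x.
Proof. by rewrite /nrm normrN. Qed.

Lemma nrmBC H (x y : H) : nrm (x - y) = nrm (y - x).
Proof. by rewrite -nrmN opprB. Qed.

Lemma nrm0 H : nrm (0 : H) = 0.
Proof. by rewrite /nrm normr0. Qed.

Lemma nrm_eq0 H (x : H) : nrm x = 0 -> x = 0.
Proof. by move=> h; apply/eqP; rewrite -normr_eq0 nrmE h. Qed.

Lemma nrmZ H (c : R[i]) (x : H) : nrm (c *: x) = complex.Re `|c| * nrm x.
Proof.
by rewrite /nrm normrZ (nrmE x) -(RRe_real (normr_real c)) -rmorphM/=.
Qed.

Lemma nrm_small H (x : H) : (forall e : R, 0 < e -> nrm x <= e) -> x = 0.
Proof.
move=> h; apply: nrm_eq0; apply/eqP; rewrite eq_le nrm_ge0 andbT.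
by apply/ler_addgt0Pl => e /h; rewrite addr0.
Qed.

Lemma cvg_nrmP H (u : nat -> H) (l : H) :
  (u @ \oo --> l) <->
  (forall e : R, 0 < e -> \forall n \near \oo, nrm (u n - l) < e).
Proof.
split.
  move=> /cvgrPdist_lt h e e0.
  have := h e%:C; rewrite ltcR => /(_ e0); apply: filterS => n.
  by rewrite nrmE ltcR nrmBC.
move=> h; apply/cvgrPdist_lt => e e0.
have er : e = (complex.Re e)%:C by rewrite RRe_real// gtr0_real.
rewrite er in e0 *; rewrite ltcR in e0.
apply: filterS (h _ e0) => n.
by rewrite nrmE ltcR nrmBC.
Qed.

Lemma closure_nrmP H (A : set H) (x : H) :
  closure A x <-> forall e : R, 0 < e -> exists2 a, A a & nrm (x - a) < e.
Proof.
split.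
  move=> cA e e0; have e0' : 0 < e%:C by rewrite ltcR.
  have [a [Aa]] := cA _ (nbhsx_ballx x e%:C e0').
  by rewrite -ball_normE/= nrmE ltcR => ?; exists a.
move=> h B; rewrite -nbhs_ballE => -[e/= e0 eB].
have er : e = (complex.Re e)%:C by rewrite RRe_real// gtr0_real.
rewrite er in e0 eB *; rewrite ltcR in e0.
have [a Aa xa] := h _ e0; exists a; split => //; apply: eB.
by rewrite -ball_normE/= nrmE ltcR.
Qed.

Lemma nrm_cauchy H (u : nat -> H) :
  (forall e : R, 0 < e -> exists N, forall m n, (N <= m)%N -> (N <= n)%N ->
     nrm (u m - u n) <= e) ->
  exists l : H, u @ \oo --> l.
Proof.
move=> h; exists (lim (u @ \oo)); apply/cauchy_cvgP/cauchy_exP => e e0.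
have er : e = (complex.Re e)%:C by rewrite RRe_real// gtr0_real.
rewrite er in e0 *; rewrite ltcR in e0.
have [|N hN] := h (complex.Re e / 2); first by rewrite divr_gt0.
exists (u N); exists N => //= n /= Nn.
rewrite -ball_normE/= nrmE ltcR (le_lt_trans (hN _ _ _ Nn))//.
by rewrite ltr_pdivrMr// ltr_pMr// ltrDl.
Qed.

Lemma bounded_op_nrm H K (T : H -> K) : linear T ->
  continuous T <-> exists2 C : R, 0 <= C & forall x, nrm (T x) <= C * nrm x.
Proof.
move=> lT.
pose f := HB.pack_for {linear H -> K} T (GRing.isLinear.Build _ _ _ _ T lT).
rewrite -[T]/(f : H -> K); split.
  move=> /linear_bounded_continuous/linear_boundedP [M [Mr hM]].
  have M1r : M + 1 \is Num.real by rewrite realD// real1.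
  have hM' := hM (M + 1); rewrite ltrDl ltr01 in hM'.
  exists (Num.max 0 (complex.Re (M+1))); first by rewrite le_max lexx.
  move=> x; have := hM' erefl x.
  rewrite -(RRe_real M1r) (nrmE (f x)) (nrmE x) -rmorphM lecR.
  move=> /le_trans; apply; apply: ler_wpM2r; first exact: nrm_ge0.
  by rewrite le_max lexx orbT.
move=> [C C0 hC]; apply/linear_bounded_continuous/linear_boundedP.
exists C%:C; split; first by rewrite realE lecR C0.
move=> r Cr x; apply: (@le_trans _ _ (C%:C * `|x|)).
  by rewrite (nrmE (f x)) (nrmE x) -rmorphM lecR.
by apply: ler_wpM2r => //; apply: ltW.
Qed.


Lemma innerDl H (x y z : H) : inner (x + y) z = inner x z + inner y z.
Proof. by rewrite -[x]scale1r inner_linear mul1r scale1r. Qed.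

Lemma inner0l H (z : H) : inner 0 z = 0.
Proof. by apply: (addrI (inner 0 z)); rewrite -innerDl !addr0. Qed.

Lemma innerZl H c (x z : H) : inner (c *: x) z = c * inner x z.
Proof. by rewrite -[c *: x]addr0 inner_linear inner0l addr0. Qed.

Lemma innerNl H (x z : H) : inner (- x) z = - inner x z.
Proof. by rewrite -scaleN1r innerZl mulN1r. Qed.

Lemma innerDr H (x y z : H) : inner z (x + y) = inner z x + inner z y.
Proof.
by rewrite inner_conj innerDl rmorphD/= -!(inner_conj _ z).
Qed.

Lemma innerZr H c (x z : H) : inner z (c *: x) = conjc c * inner z x.
Proof. by rewrite inner_conj innerZl rmorphM/= -inner_conj. Qed.

Lemma inner0r H (z : H) : inner z 0 = 0.
Proof. by rewrite inner_conj inner0l conjc0. Qed.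

Lemma innerNr H (x z : H) : inner z (- x) = - inner z x.
Proof. by rewrite inner_conj innerNl rmorphN/= -inner_conj. Qed.

Lemma inner_suml H (I : Type) (r : seq I) (P : pred I) (F : I -> H) z :
  inner (\sum_(i <- r | P i) F i) z = \sum_(i <- r | P i) inner (F i) z.
Proof.
by apply: (big_morph (fun x => inner x z)) => [x y|]; rewrite ?innerDl ?inner0l.
Qed.

Lemma inner_sumr H (I : Type) (r : seq I) (P : pred I) (F : I -> H) z :
  inner z (\sum_(i <- r | P i) F i) = \sum_(i <- r | P i) inner z (F i).
Proof. by apply: (big_morph (inner z)) => [x y|]; rewrite ?innerDr ?inner0r. Qed.

Lemma inner_nrm H (x : H) : inner x x = (nrm x ^+ 2)%:C.
Proof. by rewrite inner_norm nrmE -rmorphXn. Qed.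

Lemma nrmD_sqr H (x y : H) :
  nrm (x + y) ^+ 2 = nrm x ^+ 2 + nrm y ^+ 2 + 2 * complex.Re (inner x y).
Proof.
have E z : nrm z ^+ 2 = complex.Re (inner z z) :> R by rewrite inner_nrm.
rewrite !E innerDl !innerDr (inner_conj x y).
by case: (inner x x) (inner x y) (inner y y) => [a a'] [b b'] [c c'] /=; ring.
Qed.

Lemma Re_inner_le H (x y : H) : complex.Re (inner x y) <= nrm x * nrm y.
Proof.
have : nrm (x + y) ^+ 2 <= (nrm x + nrm y) ^+ 2.
  by rewrite ler_pXn2r// ?nnegrE ?addr_ge0 ?nrm_ge0 ?nrmD.
by rewrite nrmD_sqr; lra.
Qed.

Lemma nrm_inner_eq H K (x : H) (y : K) : inner x x = inner y y -> nrm x = nrm y.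
Proof.
rewrite !inner_nrm => /complexI h; apply/eqP.
by rewrite -(@eqrXn2 _ 2)// ?nrm_ge0// h.
Qed.

(* Lists of coefficients and indices, possibly repeated, encode finite linear
   combinations. *)
Definition lc (V : lmodType R[i]) (I : Type) (e : I -> V) (l : seq (R[i] * I)) :=
  \sum_(p <- l) p.1 *: e p.2.

Definition lscale (I : Type) (a : R[i]) (l : seq (R[i] * I)) :=
  [seq (a * p.1, p.2) | p <- l].

Lemma lc_cat (V : lmodType R[i]) (I : Type) (e : I -> V) l l' :
  lc e (l ++ l') = lc e l + lc e l'.
Proof. exact: big_cat. Qed.

Lemma lc_scale (V : lmodType R[i]) (I : Type) (e : I -> V) a l :
  lc e (lscale a l) = a *: lc e l.
Proof.
by rewrite /lc big_map scaler_sumr; apply: eq_bigr => p _; rewrite scalerA.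
Qed.

Lemma lc1 (V : lmodType R[i]) (I : Type) (e : I -> V) i :
  lc e [:: (1, i)] = e i.
Proof. by rewrite /lc big_seq1 scale1r. Qed.

Lemma lc_nil (V : lmodType R[i]) (I : Type) (e : I -> V) : lc e [::] = 0.
Proof. exact: big_nil. Qed.


Lemma linearP_D (V W : lmodType R[i]) (T : V -> W) : linear T ->
  forall x y, T (x + y) = T x + T y.
Proof. by move=> lT x y; rewrite -[x]scale1r lT !scale1r. Qed.

Lemma linearP_0 (V W : lmodType R[i]) (T : V -> W) : linear T -> T 0 = 0.
Proof. by move=> lT; apply: (addrI (T 0)); rewrite -linearP_D// !addr0. Qed.

Lemma linearP_Z (V W : lmodType R[i]) (T : V -> W) : linear T ->
  forall c x, T (c *: x) = c *: T x.
Proof. by move=> lT c x; rewrite -[c *: x]addr0 lT linearP_0// addr0. Qed.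

Lemma linearP_B (V W : lmodType R[i]) (T : V -> W) : linear T ->
  forall x y, T (x - y) = T x - T y.
Proof.
by move=> lT x y; rewrite linearP_D// -scaleN1r linearP_Z// scaleN1r.
Qed.

Lemma linearP_sum (V W : lmodType R[i]) (T : V -> W) : linear T ->
  forall (I : Type) (r : seq I) (P : pred I) (F : I -> V),
  T (\sum_(i <- r | P i) F i) = \sum_(i <- r | P i) T (F i).
Proof.
move=> lT I r P F; apply: (big_morph T) => [x y|]; first exact: linearP_D.
exact: linearP_0.
Qed.

Lemma linear_lc (V W : lmodType R[i]) (T : V -> W) (I : Type) (e : I -> V) l :
  linear T -> T (lc e l) = lc (T \o e) l.
Proof.
by move=> lT; rewrite /lc linearP_sum//; apply: eq_bigr => p _; rewrite linearP_Z.
Qed.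

(** The closed span, in a form that hands over an approximating list, which can then be evaluated in
    another family or pushed through a linear map. *)
Definition cspan H (I : Type) (e : I -> H) : set H :=
  [set x | forall eps : R, 0 < eps -> exists l, nrm (x - lc e l) < eps].

Lemma cspan_lc H (I : Type) (e : I -> H) l : cspan e (lc e l).
Proof. by move=> eps e0; exists l; rewrite subrr nrm0. Qed.

Lemma cspan_fam H (I : Type) (e : I -> H) i : cspan e (e i).
Proof. by rewrite -[X in cspan _ X](lc1 e); exact: cspan_lc. Qed.

Lemma cspan0 H (I : Type) (e : I -> H) : cspan e 0.
Proof. by rewrite -(lc_nil e); exact: cspan_lc. Qed.

Lemma cspanP H (I : Type) (e : I -> H) a x y :
  cspan e x -> cspan e y -> cspan e (a *: x + y).
Proof.
move=> hx hy eps e0; pose A : R := complex.Re `|a| + 1.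
have A0 : 0 < A by rewrite ltr_wpDl// -lecR RRe_real ?normr_real ?normr_ge0.
have [l hl] : exists l, nrm (x - lc e l) < eps / 2 / A.
  by apply: hx; rewrite !divr_gt0.
have [l' hl'] := hy _ (divr_gt0 e0 (ltr0n _ 2)).
exists (lscale a l ++ l'); rewrite lc_cat lc_scale opprD addrACA -scalerBr.
rewrite (le_lt_trans (nrmD _ _))// [ltRHS]splitr; apply: ltrD => //.
rewrite ltr_pdivlMr// in hl; rewrite nrmZ; apply: le_lt_trans hl.
by rewrite mulrC ler_wpM2l ?nrm_ge0// lerDl.
Qed.

Lemma cspan_lim H (I : Type) (e : I -> H) x :
  (forall eps : R, 0 < eps -> exists2 y, cspan e y & nrm (x - y) < eps) ->
  cspan e x.
Proof.
move=> h eps e0; have e2 := divr_gt0 e0 (ltr0n R 2).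
have [y /(_ _ e2)[l hl] xy] := h _ e2.
exists l; rewrite -(subrKA y) (le_lt_trans (nrmD _ _))//.
by rewrite [ltRHS]splitr ltrD.
Qed.

Lemma cspan_img H K (I J : Type) (e : I -> H) (b : J -> K) (T : H -> K) (C : R) :
  linear T -> (forall x, nrm (T x) <= C * nrm x) ->
  (forall i, cspan b (T (e i))) -> forall x, cspan e x -> cspan b (T x).
Proof.
move=> lT hC hb x hx; apply: cspan_lim => eps e0.
(* No sign is assumed for [C]; this denominator is positive and dominates it. *)
pose D := `|C| + 1.
have D0 : 0 < D by rewrite ltr_wpDl.
have [l hl] := hx _ (divr_gt0 e0 D0).
exists (T (lc e l)).
  rewrite linear_lc//; elim: l {hl} => [|p l IH]; first by rewrite lc_nil; exact: cspan0.
  by rewrite /lc big_cons; apply: cspanP => //; exact: hb.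
rewrite -linearP_B//; apply: le_lt_trans (hC _) _.
rewrite ltr_pdivlMr// in hl; apply: le_lt_trans hl; rewrite mulrC.
rewrite ler_wpM2l ?nrm_ge0// (le_trans (ler_norm _))// lerDl//.
Qed.

Lemma cspan_sub H (I J : Type) (e : I -> H) (b : J -> H) :
  (forall i, cspan b (e i)) -> forall x, cspan e x -> cspan b x.
Proof.
by move=> h; apply: (@cspan_img _ _ _ _ _ _ id 1) => // x; rewrite mul1r.
Qed.

Lemma linspan_lc H (I : Type) (e : I -> H) (A : set H) l :
  (forall i, A (e i)) -> linspan A (lc e l).
Proof.
move=> he; exists (size l), (fun i => (tnth (in_tuple l) i).1),
  (fun i => e (tnth (in_tuple l) i).2); split => //.
by rewrite /lc big_tnth.
Qed.

Lemma lc_linspan H (I : Type) (e : I -> H) (A : set H) x :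
  (forall a, A a -> exists i, a = e i) -> linspan A x -> exists l, x = lc e l.
Proof.
move=> he [n [c [v [vA ->]]]]; have /boolp.choice[f hf] i := he _ (vA i).
exists [seq (c i, f i) | i <- enum 'I_n].
by rewrite /lc big_map big_enum/=; apply: eq_bigr => i _; rewrite hf.
Qed.

Lemma closure_linspan H (I : Type) (e : I -> H) (A : set H) x :
  (forall a, A a -> exists i, a = e i) -> closure (linspan A) x -> cspan e x.
Proof.
move=> he /closure_nrmP h eps /h [a /(lc_linspan he)[l ->] ?].
by exists l.
Qed.

Lemma cspan_closure H (I : Type) (e : I -> H) (A : set H) x :
  (forall i, A (e i)) -> cspan e x -> closure (linspan A) x.
Proof.
move=> he h; apply/closure_nrmP => eps /h[l hl].
by exists (lc e l) => //; exact: linspan_lc.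
Qed.

Lemma inner_total0 H (I : Type) (e : I -> H) x :
  cspan e x -> (forall i, inner x (e i) = 0) -> x = 0.
Proof.
move=> hx h; apply: nrm_small => eps e0.
have [l hl] := hx _ e0.
have [->|x0] := eqVneq (nrm x) 0; first exact: ltW.
have xp : 0 < nrm x by rewrite lt_neqAle eq_sym x0 nrm_ge0.
rewrite -(ler_pM2l xp) -expr2.
have -> : nrm x ^+ 2 = complex.Re (inner x (x - lc e l)).
  rewrite innerDr innerNr /lc inner_sumr big1 => [|p _].
    by rewrite subr0 inner_nrm.
  by rewrite innerZr h mulr0.
by rewrite (le_trans (Re_inner_le _ _))// ler_pM2l// ltW.
Qed.

(** A one-sided bound on the real part is enough: it gives Re phi <= 0 on the closed span, and this
    is used at x, -x, ix and -ix. *)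
Lemma scalar_total0 H (I : Type) (e : I -> H) (phi : H -> R[i]) (C : R) :
  scalar phi -> (forall x, complex.Re (phi x) <= C * nrm x) ->
  (forall i, phi (e i) = 0) -> forall x, cspan e x -> phi x = 0.
Proof.
move=> sphi hC h0.
have phiD x y : phi (x + y) = phi x + phi y by rewrite -[x]scale1r sphi mul1r scale1r.
have phi0 : phi 0 = 0 by apply: (addrI (phi 0)); rewrite -phiD !addr0.
have phiZ c x : phi (c *: x) = c * phi x by rewrite -[c *: x]addr0 sphi phi0 addr0.
have le0 x : cspan e x -> complex.Re (phi x) <= 0.
  move=> hx; apply/ler_addgt0Pl => eps e0.
  have D0 : 0 < `|C| + 1 by rewrite ltr_wpDl.
  have [l hl] := hx _ (divr_gt0 e0 D0).
  have -> : phi x = phi (x - lc e l).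
    rewrite phiD -scaleN1r phiZ /lc (big_morph phi phiD phi0) big1 ?mulr0 ?addr0//.
    by move=> p _; rewrite phiZ h0 mulr0.
  rewrite addr0; apply: le_trans (hC _) _.
  rewrite ltr_pdivlMr// mulrC in hl; apply: le_trans (ltW hl).
  by rewrite ler_wpM2r ?nrm_ge0// (le_trans (ler_norm _))// lerDl.
have cZ c x : cspan e x -> cspan e (c *: x).
  by move=> hx; rewrite -[c *: x]addr0; apply: cspanP => //; exact: cspan0.
move=> x hx.
have := le0 _ hx; have := le0 _ (cZ (-1) _ hx); have := le0 _ (cZ 'i _ hx).
have := le0 _ (cZ (- 'i) _ hx); rewrite !phiZ.
case: (phi x) => a b /= h1 h2 h3 h4; apply/eqP; rewrite eq_complex/= .
by apply/andP; split; apply/eqP; lra.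
Qed.

(** The bound on combinations makes the images of approximating lists Cauchy. The limit [T x] is
    characterised by nrm (T x - lc b l) <= C * nrm (x - lc e l) for all [l]; the empty list then
    gives the bound, a singleton gives the values, and linearity follows by approximating both
    arguments. *)
Lemma extension H K (I : Type) (e : I -> H) (b : I -> K) (C : R) :
  0 <= C -> (forall x, cspan e x) ->
  (forall l, nrm (lc b l) <= C * nrm (lc e l)) ->
  exists T : H -> K, [/\ linear T, forall x, nrm (T x) <= C * nrm x &
    forall i, T (e i) = b i].
Proof.
move=> C0 he hb.
have hB l l' : nrm (lc b l - lc b l') <= C * nrm (lc e l - lc e l').
  have := hb (l ++ lscale (-1) l').
  by rewrite !lc_cat !lc_scale !scaleN1r.
have /boolp.choice[T hT] x : exists z : K, forall l, nrm (z - lc b l) <= C * nrm (x - lc e l).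
  have inv0 n : (0 : R) < n.+1%:R^-1 by rewrite invr_gt0.
  have /boolp.choice[u hu] n : exists l, nrm (x - lc e l) < n.+1%:R^-1.
    exact: he.
  have small (c : R) : 0 <= c -> forall eps, 0 < eps ->
      exists N, forall n, (N <= n)%N -> c * n.+1%:R^-1 <= eps.
    move=> c0 eps e0; exists (Num.truncn (c / eps)) => n Nn.
    rewrite ler_pdivrMr// mulrC -ler_pdivrMr//.
    apply: ltW; apply: lt_le_trans (truncnS_gt _) _.
    by rewrite ler_nat ltnS.
  have [z hz] : exists z : K, (fun n => lc b (u n)) @ \oo --> z.
    apply: nrm_cauchy => eps e0.
    have [N hN] := small (C * 2) (mulr_ge0 C0 (ler0n _ 2)) eps e0.
    exists N => m n Nm Nn; apply: le_trans (hB _ _) _.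
    apply: le_trans (hN N (leqnn _)); rewrite -mulrA ler_wpM2l//.
    rewrite -(subrKA x) (le_trans (nrmD _ _))// mulr_natl mulr2n lerD//.
      rewrite nrmBC; apply: le_trans (ltW (hu m)) _.
      by rewrite lef_pV2 ?posrE// ler_nat.
    apply: le_trans (ltW (hu n)) _.
    by rewrite lef_pV2 ?posrE// ler_nat.
  exists z => l; apply/ler_addgt0Pl => eps e0.
  have e2 := divr_gt0 e0 (ltr0n R 2).
  have [N hN] := small C C0 _ e2.
  move/cvg_nrmP: hz => /(_ _ e2)[M _ hM].
  pose n := maxn N M.
  have := hM n; rewrite /= leq_maxr => /(_ isT) zn.
  rewrite -(subrKA (lc b (u n))) (le_trans (nrmD _ _))// [eps]splitr -addrA lerD//.
    by rewrite nrmBC ltW.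
  apply: le_trans (hB _ _) _.
  apply: le_trans (_ : C * (n.+1%:R^-1 + nrm (x - lc e l)) <= _).
    rewrite ler_wpM2l// -(subrKA x) (le_trans (nrmD _ _))// lerD2r nrmBC.
    exact: ltW.
  by rewrite mulrDr lerD2r; apply: hN; rewrite leq_maxl.
exists T; split => [a x y|x|i].
- apply/eqP; rewrite -subr_eq0; apply/eqP; apply: nrm_small => eps e0.
  pose A : R := complex.Re `|a|.
  have A0 : 0 <= A by rewrite -lecR RRe_real ?normr_real ?normr_ge0.
  (* The errors below add up to 2 C (A + 1) d; with C + 1 in place of C the denominator stays
     positive and a slack of 2 (A + 1) d remains. *)
  have B0 : 0 < 2 * (C + 1) * (A + 1) by rewrite !mulr_gt0// ltr_wpDl.
  have [l hl] := he x _ (divr_gt0 e0 B0).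
  have [l' hl'] := he y _ (divr_gt0 e0 B0).
  set d := eps / _ in hl hl'.
  have d0 : 0 < d by rewrite divr_gt0.
  have -> : T (a *: x + y) - (a *: T x + T y) =
      (T (a *: x + y) - lc b (lscale a l ++ l')) +
      - (a *: (T x - lc b l) + (T y - lc b l')).
    by rewrite lc_cat lc_scale scalerBr [a *: T x - _ + _]addrACA -opprD [- (_ - _)]opprB subrKA.
  have h1 := hT (a *: x + y) (lscale a l ++ l').
  rewrite (lc_cat e) (lc_scale e) opprD addrACA -scalerBr in h1.
  have h2 : nrm (a *: (x - lc e l) + (y - lc e l')) <= A * d + d.
    rewrite (le_trans (nrmD _ _))// nrmZ lerD ?(ltW hl')//.
    by rewrite ler_wpM2l// ltW.
  have h3 : nrm (a *: (T x - lc b l) + (T y - lc b l')) <= A * (C * d) + C * d.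
    rewrite (le_trans (nrmD _ _))// nrmZ lerD//.
      by rewrite ler_wpM2l// (le_trans (hT _ _))// ler_wpM2l// ltW.
    by rewrite (le_trans (hT _ _))// ler_wpM2l// ltW.
  rewrite (le_trans (nrmD _ _))// nrmN lc_cat lc_scale.
  have -> : eps = C * (A * d + d) + (A * (C * d) + C * d) + 2 * (A + 1) * d.
    transitivity ((2 * (C + 1) * (A + 1)) * d); last by ring.
    by rewrite /d mulrC divfK// gt_eqF.
  have t0 : 0 <= 2 * (A + 1) * d.
    by apply: mulr_ge0 (ltW d0); apply: mulr_ge0 => //; apply: addr_ge0.
  rewrite lc_cat lc_scale in h1.
  have h4 := le_trans h1 (ler_wpM2l C0 h2).
  by apply: le_trans (lerD h4 h3) _; rewrite lerDl.
- by have := hT x [::]; rewrite !lc_nil !subr0.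
- have := hT (e i) [:: (1, i)]; rewrite !lc1 subrr nrm0 mulr0 => h.
  by apply/eqP; rewrite -subr_eq0; apply/eqP; apply: nrm_small => eps /ltW; exact: le_trans.
Qed.

End Hilbert.

(** * Riesz representation, adjoints, multipliers of a graded total family *)

Section HilbertOps.
Variable R : realType.
Implicit Types H K : hilbert R.

Lemma eq_total H K (I : Type) (e : I -> H) (T S : H -> K) (C C' : R) :
  linear T -> linear S -> (forall x, nrm (T x) <= C * nrm x) ->
  (forall x, nrm (S x) <= C' * nrm x) -> (forall i, T (e i) = S (e i)) ->
  forall x, cspan e x -> T x = S x.
Proof.
move=> lT lS hT hS hTS x hx; apply/eqP; rewrite -subr_eq0; apply/eqP.
apply: nrm_small => eps e0.
have D0 : 0 < `|C + C'| + 1 by rewrite ltr_wpDl.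
have [l hl] := hx _ (divr_gt0 e0 D0).
have -> : T x - S x = T (x - lc e l) - S (x - lc e l).
  rewrite (linearP_B lT) (linearP_B lS) (linear_lc _ _ lT) (linear_lc _ _ lS).
  have -> : lc (T \o e) l = lc (S \o e) l.
    by apply: eq_bigr => p _ /=; rewrite hTS.
  by rewrite opprB addrA subrK.
rewrite (le_trans (nrmD _ _))// nrmN (le_trans (lerD (hT _) (hS _)))// -mulrDl.
rewrite ltr_pdivlMr// mulrC in hl; apply: le_trans (ltW hl).
by rewrite ler_wpM2r ?nrm_ge0// (le_trans (ler_norm _))// lerDl.
Qed.

Lemma inner_inj H (y y' : H) : (forall x, inner x y = inner x y') -> y = y'.
Proof.
move=> h; apply/eqP; rewrite -subr_eq0; apply/eqP.
apply: (@inner_total0 _ _ _ id); first exact: cspan_fam.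
by move=> x; rewrite inner_conj innerDr innerNr h subrr conjc0.
Qed.

Lemma small_inv (c eps : R) : 0 < eps ->
  exists N, forall n, (N <= n)%N -> c * n.+1%:R^-1 <= eps.
Proof.
move=> e0; exists (Num.truncn (`|c| / eps)) => n Nn.
rewrite ler_pdivrMr// mulrC -ler_pdivrMr//.
apply: le_trans (_ : `|c| / eps <= _).
  by rewrite ler_pM2r ?invr_gt0// ler_norm.
apply: ltW; apply: lt_le_trans (truncnS_gt _) _.
by rewrite ler_nat ltnS.
Qed.

Lemma Re_inner_abs H (x y : H) : `|complex.Re (inner x y)| <= nrm x * nrm y.
Proof.
rewrite ler_norml Re_inner_le andbT lerNl.
have := Re_inner_le (- x) y; rewrite innerNl nrmN.
by case: (inner x y).
Qed.

(** Variational proof: the representing vector minimises f(x) = |x|^2 - 2 Re phi(x). The vanishing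
    of the first variation gives equality of real parts, and the same at -iv gives the imaginary
    parts. *)
Lemma riesz H (phi : H -> R[i]) (C : R) :
  scalar phi -> (forall x, complex.Re (phi x) <= C * nrm x) ->
  exists y, forall x, phi x = inner x y.
Proof.
move=> sphi hC.
have phiD x y : phi (x + y) = phi x + phi y by rewrite -[x]scale1r sphi mul1r scale1r.
have phi0 : phi 0 = 0 by apply: (addrI (phi 0)); rewrite -phiD !addr0.
have phiZ c x : phi (c *: x) = c * phi x by rewrite -[c *: x]addr0 sphi phi0 addr0.
pose f x : R := nrm x ^+ 2 - 2 * complex.Re (phi x).
have f_ge x : - (C ^+ 2) <= f x.
  rewrite /f; have := hC x; move: (complex.Re (phi x)) (nrm x) => a b ab.
  by have := sqr_ge0 (b - C); rewrite expr2; nra.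
have hinf : has_inf (range f).
  by split; [exists (f 0), 0|exists (- C ^+ 2) => _ [x _ <-]; exact: f_ge].
pose m := inf (range f).
have mf x : m <= f x by apply: ge_inf; [exact: hinf.2|exists x].
have /boolp.choice[u hu] n : exists x, f x < m + n.+1%:R^-1.
  have n0 : 0 < n.+1%:R^-1 :> R by rewrite invr_gt0.
  by have [_ [x _ <-] ?] := inf_adherent n0 hinf; exists x.
(* The parallelogram identity, with [m] bounding [f] from below at the midpoint; it makes minimising
   sequences Cauchy. *)
have hD x y : nrm (x - y) ^+ 2 <= 2 * (f x - m) + 2 * (f y - m).
  have := mf ((2^-1)%:C *: (x + y)).
  rewrite /f nrmZ phiZ phiD normc_def/= expr0n/= addr0 sqrtr_sqr ger0_norm//.
  rewrite exprMn !nrmD_sqr nrmN innerNr.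
  case: (phi x) (phi y) (inner x y) => [a a'] [b b'] [c c'] /=.
  rewrite mul0r subr0 !exprVn.
  move: (nrm x ^+ 2) (nrm y ^+ 2) => X Y; lra.
have [z hz] : exists z : H, u @ \oo --> z.
  apply: nrm_cauchy => eps e0.
  have [N hN] := small_inv 4 (exprn_gt0 2 e0).
  exists N => p q Np Nq.
  rewrite -(@ler_pXn2r _ 2)// ?nnegrE ?nrm_ge0// ?(ltW e0)//.
  apply: le_trans (hD _ _) _; have := hN _ (leqnn _).
  have h n : (N <= n)%N -> f (u n) - m <= N.+1%:R^-1.
    move=> Nn; rewrite lerBlDl; apply: le_trans (ltW (hu n)) _.
    by rewrite lerD2l lef_pV2 ?posrE// ler_nat.
  have := h _ Np; have := h _ Nq; move: (N.+1%:R^-1) (f (u p)) (f (u q)) => w y y'.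
  by lra.
have hRe v : complex.Re (inner v z) = complex.Re (phi v).
  set a := complex.Re (inner v z) - complex.Re (phi v).
  (* A quadratic in [t] without constant term that is nonnegative has no linear term. It is tested
     at t = -a/V, where V = |v|^2 + 1 avoids a case split on v = 0. *)
  suff h t : 0 <= 2 * t * a + t ^+ 2 * nrm v ^+ 2.
    pose V := nrm v ^+ 2 + 1; have V1 : 1 <= V by rewrite lerDr sqr_ge0.
    have := h (- a / V); have -> : nrm v ^+ 2 = V - 1 by rewrite addrK.
    have -> : 2 * (- a / V) * a + (- a / V) ^+ 2 * (V - 1) =
        - ((a / V) ^+ 2 * (V + 1)).
      by field; rewrite gt_eqF// (lt_le_trans _ V1).
    rewrite oppr_ge0 pmulr_lle0; last by rewrite ltr_pwDr// (le_trans _ V1).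
    move=> h0; have : (a / V) ^+ 2 == 0 by rewrite eq_le h0 sqr_ge0.
    rewrite expf_eq0/= mulf_eq0 invr_eq0 (gt_eqF (lt_le_trans _ V1))// orbF.
    by rewrite subr_eq0 => /eqP.
  apply/ler_addgt0Pl => eps e0.
  have e2 := divr_gt0 e0 (ltr0n R 2).
  have [N hN] := small_inv 1 e2.
  (* The limit [z] is approached only through the sequence [u]; [B] bounds the factor by which
     replacing [u n] with [z] changes the linear term. *)
  pose B := 2 * `|t| * nrm v + 1.
  have B0 : 0 < B by rewrite ltr_wpDl// !mulr_ge0// nrm_ge0.
  move/cvg_nrmP: hz => /(_ _ (divr_gt0 e2 B0))[M _ hM].
  pose n := maxn N M.
  have := hM n; rewrite /= leq_maxr => /(_ isT) zn.
  have := hN n; rewrite leq_maxl mul1r => /(_ isT) hn.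
  have h1 : m <= f (u n + t%:C *: v) := mf _.
  have h2 := hu n.
  have h3 : `|complex.Re (inner v (u n - z))| <= nrm v * nrm (u n - z) := Re_inner_abs _ _.
  have h4 : 2 * t * complex.Re (inner v (u n - z)) <= eps / 2.
    apply: le_trans (ler_norm _) _; rewrite !normrM (ger0_norm (ler0n R 2)).
    apply: le_trans (ler_wpM2l _ h3) _; first by rewrite mulr_ge0.
    rewrite mulrA; rewrite ltr_pdivlMr// mulrC in zn; apply: le_trans (ltW zn).
    by rewrite ler_wpM2r ?nrm_ge0// lerDl.
  move: h1 h4; rewrite /f phiD phiZ nrmD_sqr nrmZ innerDr innerNr inner_conj innerZl.
  rewrite normc_def/= expr0n/= addr0 sqrtr_sqr exprMn real_normK ?num_real//.
  rewrite /a; move: h2; rewrite /f.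
  case: (phi v) (phi (u n)) (inner v (u n)) (inner v z) => [p p'] [q q'] [r r'] [s s'] /=.
  move: hn e0; move: (nrm v) (nrm (u n)) (n.+1%:R^-1) => X Y w.
  by rewrite !mul0r !subr0 mulrBr; move=> *; nra.
exists z => v; have h1 := hRe v; have h2 := hRe ((- 'i) *: v).
move: h1 h2; rewrite phiZ innerZl; case: (phi v) (inner v z) => [a a'] [b b'] /= -> h.
by congr (_ +i* _); lra.
Qed.

Lemma adjP H (T : H -> H) : bounded_op T ->
  forall x y, inner (T x) y = inner x (adj T y).
Proof.
move=> [lT cT]; have [C C0 hC] := (bounded_op_nrm lT).1 cT.
have /boolp.choice[T' hT'] y : exists z, forall x, inner (T x) y = inner x z.
  apply: (@riesz _ _ (C * nrm y)) => [a u v|x].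
    by rewrite lT innerDl innerZl.
  apply: le_trans (Re_inner_le _ _) _.
  by rewrite mulrAC ler_wpM2r ?nrm_ge0.
have hg : [set T' : H -> H | forall x y, inner (T x) y = inner x (T' y)] (adj T).
  by apply: getPex; exists T' => x y.
exact: hg.
Qed.

Lemma adj_bounded_op H (T : H -> H) : bounded_op T -> bounded_op (adj T).
Proof.
move=> bT; have hT := adjP bT; case: bT => lT cT.
have [C C0 hC] := (bounded_op_nrm lT).1 cT.
have lA : linear (adj T).
  move=> a x y; apply: inner_inj => z.
  by rewrite -hT !innerDr !innerZr -!hT.
split=> //; apply/(bounded_op_nrm lA); exists C => // x.
have [->|x0] := eqVneq (nrm (adj T x)) 0; first by rewrite mulr_ge0 ?nrm_ge0.
have xp : 0 < nrm (adj T x) by rewrite lt_neqAle eq_sym x0 nrm_ge0.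
rewrite -(ler_pM2l xp) -expr2.
have -> : nrm (adj T x) ^+ 2 = complex.Re (inner (T (adj T x)) x).
  by rewrite hT inner_nrm.
apply: le_trans (Re_inner_le _ _) _.
by rewrite mulrA ler_wpM2r ?nrm_ge0// mulrC.
Qed.

Lemma nrm_sum_orth H (D : eqType) (s : seq D) (y : D -> H) : uniq s ->
  (forall a b, a != b -> inner (y a) (y b) = 0) ->
  nrm (\sum_(a <- s) y a) ^+ 2 = \sum_(a <- s) nrm (y a) ^+ 2.
Proof.
move=> us hy; elim: s us => [|a s IH]; first by rewrite !big_nil nrm0 expr0n.
move=> /=/andP[sa us]; rewrite !big_cons nrmD_sqr IH// inner_sumr.
rewrite [X in complex.Re X]big_seq [X in complex.Re X]big1 ?mulr0 ?addr0// => b sb.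
by apply: hy; apply: contraNneq sa => ->.
Qed.

End HilbertOps.

Section Multiplier.
Variables (R : realType) (H : hilbert R) (I : Type) (e : I -> H) (D : eqType)
  (d : I -> D).
Hypothesis e_total : forall x, cspan e x.
Hypothesis e_orth : forall i j, d i != d j -> inner (e i) (e j) = 0.
Implicit Types m : D -> R.

Definition contractive m := forall a, 0 <= m a <= 1.

(** Diagonal operators for an orthogonal grading by an arbitrary [D]: chaos projections and P_t for
    the degree, bidegree projections and the tensor square of P_t for pairs of degrees. *)
Definition mult_spec m (T : H -> H) :=
  [/\ linear T, forall x, nrm (T x) <= nrm x &
      forall i, T (e i) = (m (d i))%:C *: e i].

Definition mult m : H -> H := get [set T | mult_spec m T].

(** Grouping the list by degree makes the groups mutually orthogonal, so Pythagoras applies.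
    Compared with the case m = 1, the formula gives the contraction bound. *)
Lemma lc_mult m l : nrm (lc (fun i => (m (d i))%:C *: e i) l) ^+ 2 =
  \sum_(a <- undup [seq d p.2 | p <- l]) (m a) ^+ 2 *
    nrm (\sum_(p <- l | d p.2 == a) p.1 *: e p.2) ^+ 2.
Proof.
set s := undup _.
have -> : lc (fun i => (m (d i))%:C *: e i) l =
    \sum_(a <- s) (m a)%:C *: \sum_(p <- l | d p.2 == a) p.1 *: e p.2.
  under [RHS]eq_bigr do rewrite scaler_sumr.
  rewrite (exchange_big_dep xpredT)//=.
  have : all (fun p => d p.2 \in s) l.
    rewrite -(all_map (fun p : R[i] * I => d p.2) (mem s)).
    by apply/allP => a; rewrite inE mem_undup.
  have : uniq s := undup_uniq _.
  elim: l s => [|p l IH] s us; first by rewrite lc_nil big_nil.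
  rewrite /lc !big_cons => /andP[ps ls]; congr (_ + _); last exact: IH.
  rewrite -big_filter (eq_filter (a2 := pred1 (d p.2))); last first.
    by move=> a; rewrite /= eq_sym.
  by rewrite filter_pred1_uniq// big_seq1 !scalerA mulrC.
rewrite nrm_sum_orth ?undup_uniq//.
  apply: eq_bigr => a _; rewrite nrmZ exprMn normc_def/= expr0n/= addr0 sqrtr_sqr.
  by rewrite real_normK ?num_real.
move=> a b ab; rewrite innerZl innerZr inner_suml big1 ?mulr0// => p /eqP pa.
rewrite inner_sumr big1// => q /eqP qb.
by rewrite innerZl innerZr e_orth ?mulr0// pa qb.
Qed.

Lemma multP m : contractive m -> mult_spec m (mult m).
Proof.
move=> hm; have hl l : nrm (lc (fun i => (m (d i))%:C *: e i) l) <= 1 * nrm (lc e l).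
  rewrite mul1r -(@ler_pXn2r _ 2)// ?nnegrE ?nrm_ge0//.
  have -> : lc e l = lc (fun i => ((fun _ => 1) (d i))%:C *: e i) l.
    by apply: eq_bigr => p _; rewrite scale1r.
  rewrite !(lc_mult m) (lc_mult (fun _ => 1)); apply: ler_sum => a _.
  rewrite ler_wpM2r ?sqr_ge0//.
  by have /andP[m0 m1] := hm a; rewrite ler_pXn2r// nnegrE.
have [T [lT bT eT]] := extension ler01 e_total hl.
apply: (getPex (P := [set T | mult_spec m T])); exists T; split => //.
by move=> x; have := bT x; rewrite mul1r.
Qed.

Lemma mult_eq m (T : H -> H) (C : R) : contractive m -> linear T ->
  (forall x, nrm (T x) <= C * nrm x) ->
  (forall i, T (e i) = (m (d i))%:C *: e i) -> T = mult m.
Proof.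
move=> hm lT bT eT; have [lM bM eM] := multP hm; apply/funext => x.
apply: (@eq_total _ _ _ _ e _ _ C 1) => //= [y|i]; first by rewrite mul1r.
by rewrite eT eM.
Qed.

(** Self-adjointness, tested on the family: both sides are bounded functionals of [x], and on [e i]
    with a degree other than that of [e j] both vanish by orthogonality. *)
Lemma mult_inner m x j : contractive m ->
  inner (mult m x) (e j) = (m (d j))%:C * inner x (e j).
Proof.
move=> hm; have [lM bM eM] := multP hm.
apply/eqP; rewrite -subr_eq0; apply/eqP.
apply: (@scalar_total0 _ _ _ e (fun x => inner (mult m x) (e j) -
  (m (d j))%:C * inner x (e j)) (nrm (e j) + nrm ((m (d j))%:C *: e j))) => //.
- by move=> a u v; rewrite lM !innerDl !innerZl; ring.
- move=> y; have -> : (m (d j))%:C * inner y (e j) = inner y ((m (d j))%:C *: e j).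
    by rewrite innerZr conjc_real.
  rewrite mulrDl; have -> (a b : R[i]) : complex.Re (a - b) = complex.Re a - complex.Re b.
    by case: a b => [? ?] [].
  apply: lerD; first by rewrite (le_trans (Re_inner_le _ _))// mulrC ler_wpM2l ?nrm_ge0.
  by have := Re_inner_abs y ((m (d j))%:C *: e j); rewrite ler_norml lerNl mulrC => /andP[].
- move=> i; rewrite eM innerZl.
  have [->|ij] := eqVneq (d i) (d j); first by rewrite subrr.
  by rewrite e_orth// !mulr0 subrr.
Qed.

Definition proj (a : D) := mult (fun b => (b == a)%:R).

Lemma contr_proj a : contractive (fun b => (b == a)%:R).
Proof. by move=> b; rewrite ler0n lern1 leq_b1. Qed.

Lemma proj_eq0 x : (forall a, proj a x = 0) -> x = 0.
Proof.
move=> h; apply: (inner_total0 (e_total x)) => i.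
have := mult_inner x i (contr_proj (d i)).
by rewrite [mult _ x]h inner0l eqxx mul1r.
Qed.

End Multiplier.

Section NatGraded.
Variables (R : realType) (H : hilbert R) (I : Type) (e : I -> H) (d : I -> nat).
Hypothesis e_total : forall x, cspan e x.
Hypothesis e_orth : forall i j, d i != d j -> inner (e i) (e j) = 0.

(** A partial sum is the multiplier truncated at degree N. The truncations are contractions
    uniformly in N, and on a finite combination they are exact for large N, so density gives the
    convergence. *)
Lemma mult_series (m : nat -> R) (F : H) : contractive m ->
  series (fun n => (m n)%:C *: proj e d n F) @ \oo --> mult e d m F.
Proof.
move=> hm.
have hP n := multP e_total e_orth (@contr_proj R _ n).
have [lM bM eM] := multP e_total e_orth hm.
pose mN N := fun n => (n < N)%:R * m n : R.
have cN N : contractive (mN N).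
  move=> n; have /andP[m0 m1] := hm n; rewrite /mN.
  by case: (n < N)%N; rewrite ?mul1r ?mul0r ?lexx ?ler01 ?m0 ?m1.
have sN N x : series (fun n => (m n)%:C *: proj e d n x) N = mult e d (mN N) x.
  have [lT bT eT] := multP e_total e_orth (cN N).
  rewrite /series/= big_mkord.
  (* A crude bound suffices here: it only makes the partial sum a bounded operator, so that it can
     be identified on the total family. *)
  have bS y : nrm (\sum_(n < N) (m n)%:C *: proj e d n y) <= N%:R * nrm y.
    elim: N {cN eT bT lT} => [|N IH]; first by rewrite big_ord0 nrm0 mul0r.
    rewrite big_ord_recr/= (le_trans (nrmD _ _))// -natr1 mulrDl mul1r lerD// nrmZ.
    have [_ /(_ y) h _] := hP N; have /andP[m0 m1] := hm N.
    rewrite normc_def/= expr0n/= addr0 sqrtr_sqr ger0_norm//.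
    by rewrite (le_trans _ h)// -[leRHS]mul1r ler_wpM2r ?nrm_ge0.
  apply: (@eq_total _ _ _ _ e (fun y => \sum_(n < N) (m n)%:C *: proj e d n y)
    (mult e d (mN N)) N%:R 1) => //.
  - move=> a u v; rewrite scaler_sumr -big_split; apply: eq_bigr => n _ /=.
    by have [lP _ _] := hP n; rewrite /proj lP scalerDr !scalerA mulrC.
  - by move=> y; rewrite mul1r.
  - move=> i; rewrite eT /mN.
    have [dN|dN] := ltnP (d i) N.
      rewrite mul1r (bigD1 (Ordinal dN))//= big1 ?addr0 => [|n nd].
        by have [_ _ eP] := hP (d i); rewrite /proj eP eqxx scale1r.
      have [_ _ eP] := hP n; rewrite /proj eP.
      by rewrite (_ : d i == n = false) ?scale0r ?scaler0//; apply: contraNF nd => /eqP h; apply/eqP/val_inj.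
    rewrite mul0r scale0r big1// => n _; have [_ _ eP] := hP n; rewrite /proj eP.
    by rewrite gtn_eqF ?scale0r ?scaler0// (leq_trans (ltn_ord n)).
apply/cvg_nrmP => eps e0.
have [l hl] := e_total F (divr_gt0 e0 (ltr0n R 2)).
(* Beyond every degree in [l] the truncation does not change the multiplier on [lc e l], so only the
   remainder F - lc e l contributes, once for each operator. *)
exists (\max_(p <- l) (d p.2).+1)%N => // N /= hN.
have [lT bT eT] := multP e_total e_orth (cN N).
rewrite sN.
have -> : mult e d (mN N) F - mult e d m F =
    mult e d (mN N) (F - lc e l) - mult e d m (F - lc e l).
  rewrite (linearP_B lM) (linearP_B lT) (linear_lc _ _ lM) (linear_lc _ _ lT).
  have -> : lc (mult e d (mN N) \o e) l = lc (mult e d m \o e) l.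
    elim: l hN {hl} => [|p l IH]; first by rewrite !lc_nil.
    rewrite big_cons geq_max => /andP[pN lN].
    by rewrite /lc !big_cons [X in _ + X = _](IH lN)/= eT eM /mN pN mul1r.
  by rewrite opprB addrA subrK.
rewrite (le_lt_trans (nrmD _ _))// nrmN [ltRHS]splitr.
by apply: ltrD; apply: le_lt_trans hl.
Qed.

End NatGraded.

(** * The Fock space and its field operators *)

Section OneParticle.
Variable R : realType.
Implicit Types h g : L2half R.

Lemma Lfun2_0 : (fun=> 0) \in Lfun (@lebesgue_half R) 2%:E.
Proof.
have p1 : (1 <= (2%:E : \bar R))%E by rewrite lee_fin ler1n.
by have [] := @Lfun_submod_closed _ _ R (@lebesgue_half R) _ p1.
Qed.

Lemma is_L2_re h : is_L2 (fun s => (complex.Re (h s))%:C).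
Proof. by split => /=; [exact: (L2halfP h).1|exact: Lfun2_0]. Qed.

Lemma is_L2_im h : is_L2 (fun s => (complex.Im (h s))%:C).
Proof. by split => /=; [exact: (L2halfP h).2|exact: Lfun2_0]. Qed.

(** The letters of Wick words: only real functions give field operators in the algebra. Complex ones
    are recovered from their real and imaginary parts. *)
Definition rL2 := {h : L2half R | L2half_real h}.

Definition re_L2 h : rL2 :=
  exist (@L2half_real R) (L2Half (is_L2_re h)) (fun _ => erefl).
Definition im_L2 h : rL2 :=
  exist (@L2half_real R) (L2Half (is_L2_im h)) (fun _ => erefl).

Lemma integrable_mul2 (f g : R -> R) :
  f \in Lfun (@lebesgue_half R) 2%:E -> g \in Lfun (@lebesgue_half R) 2%:E ->
  (@lebesgue_half R).-integrable setT (EFin \o (fun s => f s * g s)).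
Proof. by move=> hf hg; apply/Lfun1_integrable; exact: Lfun2_mul_Lfun1. Qed.

Lemma inner_L2half_re_im h g :
  inner_L2half h g =
  inner_L2half (sval (re_L2 h)) g + 'i * inner_L2half (sval (im_L2 h)) g.
Proof.
have [hr hi] := L2halfP h; have [gr gi] := L2halfP g.
have i1 := integrable_mul2 hr gr; have i2 := integrable_mul2 hi gi.
have i3 := integrable_mul2 hi gr; have i4 := integrable_mul2 hr gi.
rewrite /inner_L2half /=.
have e1 s : complex.Re (h s * (g s)^*) =
    complex.Re (h s) * complex.Re (g s) + complex.Im (h s) * complex.Im (g s).
  by case: (h s) (g s) => [a b] [c d] /=; ring.
have e2 s : complex.Im (h s * (g s)^*) =
    complex.Im (h s) * complex.Re (g s) - complex.Re (h s) * complex.Im (g s).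
  by case: (h s) (g s) => [a b] [c d] /=; ring.
have e3 (x : R) (z : R[i]) : complex.Re (x%:C * z^*) = x * complex.Re z.
  by case: z => [c d] /=; ring.
have e4 (x : R) (z : R[i]) : complex.Im (x%:C * z^*) = - 1 * (x * complex.Im z).
  by case: z => [c d] /=; ring.
under eq_Rintegral do rewrite e1.
under [X in _ +i* X = _]eq_Rintegral do rewrite e2.
under [X in _ = X +i* _ + _]eq_Rintegral do rewrite e3.
under [X in _ = _ +i* X + _]eq_Rintegral do rewrite e4.
under [X in _ = _ + _ * (X +i* _)]eq_Rintegral do rewrite e3.
under [X in _ = _ + _ * (_ +i* X)]eq_Rintegral do rewrite e4.
rewrite RintegralD// RintegralB// !RintegralZl//.
by apply/eqP; rewrite eq_complex/=; apply/andP; split; apply/eqP; ring.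
Qed.

Lemma inner_L2half_real h g : L2half_real h -> L2half_real g ->
  inner_L2half h g =
  (\int[lebesgue_half R]_s (complex.Re (h s) * complex.Re (g s)))%:C.
Proof.
move=> hr gr; rewrite /inner_L2half; congr (_ +i* _).
  apply: eq_Rintegral => s _; move: (hr s) (gr s).
  by case: (h s) (g s) => [a b] [c d] /= -> ->; ring.
transitivity (\int[lebesgue_half R]_s (0 : R)); last first.
  by rewrite Rintegral_cst// mul0r.
apply: eq_Rintegral => s _; move: (hr s) (gr s).
by case: (h s) (g s) => [a b] [c d] /= -> ->; ring.
Qed.

End OneParticle.

Section Fock.
Variables (R : realType) (Fk : full_fock R).
Implicit Types (h g : L2half R) (H K : hilbert R).

Notation vac := (vacuum Fk).

Definition ev (s : seq (rL2 R)) : Fk := etens Fk (map sval s).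

Lemma etens_total x : cspan (etens Fk) x.
Proof.
have := total_etens Fk; rewrite /total_set => h.
have : closure (linspan [set x | exists s, x = etens Fk s]) x by rewrite h.
exact: closure_linspan.
Qed.

Lemma inner_etens_cons h g s s' :
  inner (etens Fk (h :: s)) (etens Fk (g :: s')) =
  inner_L2half h g * inner (etens Fk s) (etens Fk s').
Proof.
rewrite !inner_etens/= eqSS; case: ifP => _; last by rewrite mulr0.
by rewrite big_cons.
Qed.

Lemma inner_etens1 h g :
  inner_L2half h g = inner (etens Fk [:: h]) (etens Fk [:: g]).
Proof. by rewrite inner_etens/= big_seq1. Qed.

Lemma etens_eq x y : (forall s, inner x (etens Fk s) = inner y (etens Fk s)) ->
  x = y.
Proof.
move=> h; apply/eqP; rewrite -subr_eq0; apply/eqP.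
apply: (inner_total0 (etens_total _)) => s.
by rewrite innerDl innerNl h subrr.
Qed.

(** Linearity of [etens] in a slot is not part of the structure; it is read off from the inner
    products with the total family of elementary tensors. *)
Lemma etens_re_im h s : etens Fk (h :: s) =
  etens Fk (sval (re_L2 h) :: s) + 'i *: etens Fk (sval (im_L2 h) :: s).
Proof.
apply: etens_eq => -[|g s']; rewrite innerDl innerZl.
  by rewrite !inner_etens/= mulr0 addr0.
by rewrite !inner_etens_cons inner_L2half_re_im mulrA -mulrDl.
Qed.

(** Prepending [h] multiplies every inner product of combinations by that of [h] with itself, so the
    extension bound holds, with equality, for C the norm of [h]. *)
Lemma creationP h : bounded_op (@creation R Fk h) /\
  forall s, creation h (etens Fk s) = etens Fk (h :: s).
Proof.
pose C := nrm (etens Fk [:: h]).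
have hl l : nrm (lc (fun s => etens Fk (h :: s)) l) <= C * nrm (lc (etens Fk) l).
  rewrite -(@ler_pXn2r _ 2)// ?nnegrE ?mulr_ge0 ?nrm_ge0//.
  set X := lc _ l; set Y := lc _ l.
  have : inner X X = inner (etens Fk [:: h]) (etens Fk [:: h]) * inner Y Y.
    rewrite -inner_etens1 /X /Y /lc inner_suml [X in _ * X]inner_suml mulr_sumr.
    apply: eq_bigr => p _; rewrite !inner_sumr mulr_sumr; apply: eq_bigr => q _.
    by rewrite !innerZl !innerZr inner_etens_cons; ring.
  by rewrite !inner_nrm -rmorphM => /complexI ->; rewrite exprMn.
have [T [lT bT eT]] := extension (nrm_ge0 _) etens_total hl.
apply: (getPex (P := [set T : Fk -> Fk | bounded_op T /\
         forall s, T (etens Fk s) = etens Fk (h :: s)])).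
exists T; split => //; split => //; apply/(bounded_op_nrm lT).
by exists C => //; exact: nrm_ge0.
Qed.

Lemma adj_creation_nil h : adj (@creation R Fk h) vac = 0.
Proof.
have [bC eC] := creationP h; apply: etens_eq => s.
rewrite [LHS]inner_conj -adjP// eC inner0l /vacuum inner_etens/=; exact: conjc0.
Qed.

Lemma adj_creation_cons h g s :
  adj (@creation R Fk h) (etens Fk (g :: s)) = inner_L2half g h *: etens Fk s.
Proof.
have [bC eC] := creationP h; apply: etens_eq => s'.
by rewrite inner_conj -adjP// eC -inner_conj inner_etens_cons innerZl.
Qed.

Lemma bounded_opD H K (T S : H -> K) : @bounded_op R H K T -> bounded_op S ->
  bounded_op (T \+ S).
Proof.
move=> [lT cT] [lS cS]; split => [a x y|x].
  by rewrite /= lT lS scalerDr addrACA.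
by apply: continuousD; [exact: cT|exact: cS].
Qed.

Lemma bounded_opZ H K c (T : H -> K) : @bounded_op R H K T ->
  bounded_op (fun x => c *: T x).
Proof.
move=> [lT cT]; split => [a x y|x].
  by rewrite /= lT scalerDr !scalerA mulrC.
by apply: cvgZr; exact: cT.
Qed.

Lemma bounded_op_comp H (T S : H -> H) : @bounded_op R H H T -> bounded_op S ->
  bounded_op (T \o S).
Proof.
move=> [lT cT] [lS cS]; split => [a x y|x].
  by rewrite /= lS lT.
by apply: continuous_comp; [exact: cS|exact: cT].
Qed.

Lemma bounded_op_id H : @bounded_op R H H idfun.
Proof. by split => // x; exact: cvg_id. Qed.

Lemma field_op_bounded h : bounded_op (@field_op R Fk h).
Proof.
have [bC _] := creationP h.
by apply: bounded_opD => //; exact: adj_bounded_op.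
Qed.

Lemma field_op_ev (h : rL2 R) s : field_op (sval h) (ev s) =
  ev (h :: s) +
  (if s is g :: s' then inner_L2half (sval g) (sval h) *: ev s' else 0).
Proof.
have [_ eC] := creationP (sval h).
rewrite /field_op/= /ev eC; congr (_ + _); case: s => [|g s]/=.
  exact: adj_creation_nil.
exact: adj_creation_cons.
Qed.

(** Induction on the word, applying [creation] to the approximations of the tail. The length is kept
    in the index type because the same statement later describes [fock_degree] by real words. *)
Lemma etens_cspan s :
  cspan (fun x : {s' : seq (rL2 R) | size s' = size s} => ev (sval x)) (etens Fk s).
Proof.
elim: s => [|h s IH] /=.
  exact: (cspan_fam (fun x : {s' : seq (rL2 R) | size s' = 0%N} => ev (sval x))
    (exist _ [::] erefl)).
have [[lC cC] eC] := creationP h; have [C C0 bC] := (bounded_op_nrm lC).1 cC.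
rewrite -eC; apply: (cspan_img lC bC) IH => -[s' hs'] /=.
rewrite /ev eC etens_re_im addrC; apply: cspanP.
  have hs : size (im_L2 h :: s') = (size s).+1 by rewrite /= hs'.
  exact: (cspan_fam (fun x : {s' : seq (rL2 R) | size s' = (size s).+1} => ev (sval x))
    (exist _ _ hs)).
have hs : size (re_L2 h :: s') = (size s).+1 by rewrite /= hs'.
exact: (cspan_fam (fun x : {s' : seq (rL2 R) | size s' = (size s).+1} => ev (sval x))
  (exist _ _ hs)).
Qed.

Lemma ev_total x : cspan ev x.
Proof.
apply: cspan_sub (etens_total x) => s; apply: cspan_sub (etens_cspan s) => i.
exact: cspan_fam.
Qed.

Lemma ev_orth s s' : size s != size s' -> inner (ev s) (ev s') = 0.
Proof. by rewrite /ev inner_etens !size_map => /negbTE ->. Qed.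

Lemma commutant_id (A : set (Fk -> Fk)) : commutant A idfun.
Proof. by split => //; exact: bounded_op_id. Qed.

Lemma commutant_comp (A : set (Fk -> Fk)) T S :
  commutant A T -> commutant A S -> commutant A (T \o S).
Proof.
move=> [bT cT] [bS cS]; split; first exact: bounded_op_comp.
move=> X AX; apply/funext => x /=.
have := congr1 (fun f => f x) (cS _ AX); rewrite /= => ->.
by have := congr1 (fun f => f (S x)) (cT _ AX).
Qed.

Lemma SC_bounded X : @SC R Fk X -> bounded_op X.
Proof. by case. Qed.

Lemma SC_id : @SC R Fk idfun. Proof. exact: commutant_id. Qed.

Lemma SC_comp X Y : @SC R Fk X -> SC Y -> @SC R Fk (X \o Y).
Proof. exact: commutant_comp. Qed.

Lemma SC_add X Y : @SC R Fk X -> SC Y -> @SC R Fk (X \+ Y).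
Proof.
move=> [bX cX] [bY cY]; split; first exact: bounded_opD.
move=> T hT; have [[lT _] _] := hT; apply/funext => x /=.
have := congr1 (fun f => f x) (cX _ hT); have := congr1 (fun f => f x) (cY _ hT).
by rewrite /= => -> ->; rewrite (linearP_D lT).
Qed.

Lemma SC_scale c X : @SC R Fk X -> @SC R Fk (fun x => c *: X x).
Proof.
move=> [bX cX]; split; first exact: bounded_opZ.
move=> T hT; have [[lT _] _] := hT; apply/funext => x /=.
have := congr1 (fun f => f x) (cX _ hT).
by rewrite /= => ->; rewrite (linearP_Z lT).
Qed.

Lemma SC_field h : L2half_real h -> @SC R Fk (field_op h).
Proof.
move=> hr; split; first exact: field_op_bounded.
by move=> T [_ cT]; rewrite cT//; exists h.
Qed.

Lemma grad_alg_SC A a : @grad_alg R Fk A a -> SC A.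
Proof.
elim => [|h hr|c {}A {}a _ hA|{}A {}a B b _ hA _ hB|{}A {}a B b _ hA _ hB].
- exact: SC_id.
- exact: SC_field.
- exact: SC_scale.
- exact: SC_add.
- exact: SC_comp.
Qed.

End Fock.

(** * The gradient on words in the field operators *)

Fixpoint splits (T : Type) (s : seq T) : seq (seq T * T * seq T) :=
  if s is h :: t then
    ([::], h, t) :: [seq (h :: x.1.1, x.1.2, x.2) | x <- splits t]
  else [::].

Section GradAlgebra.
Variables (R : realType) (Fk : full_fock R) (V : lmodType R[i]).
Variable B : Fk -> Fk -> V.
Hypothesis linBl : forall y, linear (B^~ y).
Hypothesis linBr : forall x, linear (B x).

Notation vac := (vacuum Fk).
Notation I := (seq (rL2 R)).
Notation ev := (@ev R Fk).

(* The gradient evaluated on vectors: [B] stands for the tensor product of the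
   two legs.  Left multiplication of [a] by an operator is absorbed in [X],
   right multiplication in the vector [z]. *)
Definition gcontr (X : Fk -> Fk) (a : formal_grad Fk) (u : R) (z : Fk) : V :=
  \sum_(v <- a) v.1.1 u *: B (X (v.1.2 vac)) (v.2 z).

(* The gradient of the Wick word of [s], multiplied on the left by [X]. *)
Definition dsplit (X : Fk -> Fk) (s : I) (u : R) : V :=
  \sum_(x <- splits s) sval x.1.2 u *: B (X (ev x.1.1)) (ev x.2).

Lemma dsplit_cons X (h : rL2 R) s u : dsplit X (h :: s) u =
  sval h u *: B (X vac) (ev s) +
  \sum_(x <- splits s) sval x.1.2 u *: B (X (ev (h :: x.1.1))) (ev x.2).
Proof. by rewrite /dsplit/= big_cons big_map. Qed.

Lemma dsplit_comp X c (Y : Fk -> Fk) s u : linear X ->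
  dsplit (X \o (fun x => c *: Y x)) s u = c *: dsplit (X \o Y) s u.
Proof.
move=> lX; rewrite /dsplit scaler_sumr; apply: eq_bigr => x _.
by rewrite /= (linearP_Z lX) (linearP_Z (linBl _)) !scalerA mulrC.
Qed.

Lemma dsplitD X (Y Z : Fk -> Fk) s u : linear X ->
  dsplit (X \o (Y \+ Z)) s u = dsplit (X \o Y) s u + dsplit (X \o Z) s u.
Proof.
move=> lX; rewrite /dsplit -big_split; apply: eq_bigr => x _.
by rewrite /= (linearP_D lX) (linearP_D (linBl _)) scalerDr.
Qed.

(** The gradient of S(h) W(s) = W(h s) + (g, h) W(s') with s = g s', computed on both sides. On the
    left leg S(h) either prepends [h], giving the splits of h s at a letter of s, or removes the
    first letter, giving the splits of s'; for the empty left leg the removal gives zero. *)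
Lemma dsplit_field X (h : rL2 R) s u : linear X ->
  dsplit (X \o field_op (sval h)) s u + sval h u *: B (X vac) (ev s) =
  dsplit X (h :: s) u +
  (if s is g :: s' then inner_L2half (sval g) (sval h) *: dsplit X s' u else 0).
Proof.
move=> lX; rewrite dsplit_cons addrC -addrA; congr (_ + _).
have -> : dsplit (X \o field_op (sval h)) s u =
    \sum_(x <- splits s) sval x.1.2 u *: B (X (ev (h :: x.1.1))) (ev x.2) +
    \sum_(x <- splits s) sval x.1.2 u *:
      B (X (if x.1.1 is g :: p then inner_L2half (sval g) (sval h) *: ev p else 0))
        (ev x.2).
  rewrite -big_split; apply: eq_bigr => x _ /=.
  by rewrite field_op_ev (linearP_D lX) (linearP_D (linBl _)) scalerDr.
congr (_ + _); case: s => [|g s]; first by rewrite big_nil.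
rewrite /= big_cons big_map/= (linearP_0 lX) (linearP_0 (linBl _)) scaler0 add0r.
rewrite /dsplit scaler_sumr; apply: eq_bigr => x _.
by rewrite (linearP_Z lX) (linearP_Z (linBl _)) !scalerA mulrC.
Qed.

Lemma gcontr_cat X a b u z :
  gcontr X (a ++ b) u z = gcontr X a u z + gcontr X b u z.
Proof. exact: big_cat. Qed.

Lemma gcontr_left X A (b : formal_grad Fk) u z :
  gcontr X [seq (v.1.1, A \o v.1.2, v.2) | v <- b] u z = gcontr (X \o A) b u z.
Proof. by rewrite /gcontr big_map. Qed.

Lemma gcontr_right X A (b : formal_grad Fk) u z :
  gcontr X [seq (v.1.1, v.1.2, v.2 \o A) | v <- b] u z = gcontr X b u (A z).
Proof. by rewrite /gcontr big_map. Qed.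

Lemma gcontr_scale X c (a : formal_grad Fk) u z : linear X ->
  gcontr X [seq (v.1.1, (fun x => c *: v.1.2 x), v.2) | v <- a] u z =
  c *: gcontr X a u z.
Proof.
move=> lX; rewrite /gcontr big_map scaler_sumr; apply: eq_bigr => v _ /=.
by rewrite (linearP_Z lX) (linearP_Z (linBl _)) !scalerA mulrC.
Qed.

(** A vector and a gradient written with one list of words. The gradient is required for every left
    multiplier [X], since the product rule replaces [X] by [X \o A]. *)
Definition grad_rel (xi : Fk) (eta : (Fk -> Fk) -> R -> V) :=
  exists l, xi = lc ev l /\
    forall X u, linear X -> eta X u = lc (fun s => dsplit X s u) l.

Lemma grad_rel_lc (l : seq (R[i] * I)) xi eta :
  (forall s, grad_rel (xi s) (eta s)) ->
  grad_rel (lc xi l) (fun X u => lc (fun s => eta s X u) l).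
Proof.
move=> h; elim: l => [|[c s] l [l' [h' e']]].
  by exists [::]; split => [|X u _]; rewrite !lc_nil.
have [k [hk ek]] := h s.
exists (lscale c k ++ l'); split=> [|X u lX].
  by rewrite {1}/lc big_cons -/(lc xi l) lc_cat lc_scale hk h'.
by rewrite {1}/lc big_cons -/(lc _ l) lc_cat lc_scale -e'// -ek.
Qed.

(* Quantifying over all [ev s], and not the vacuum only, is what makes the
   property stable under products. *)
Definition grad_inv A (a : formal_grad Fk) :=
  [/\ linear A, forall X u, linear (gcontr X a u) &
    forall s, grad_rel (A (ev s))
      (fun X u => dsplit (X \o A) s u + gcontr X a u (ev s))].

Lemma grad_alg_inv A a : grad_alg A a -> grad_inv A a.
Proof.
elim => {A a} [|h hr|c A a _ [lA la rA]|A a b' b _ [lA la rA] _ [lB lb rB]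
  |A a b' b _ [lA la rA] _ [lB lb rB]].
- split => // [X u c x y|s].
    by rewrite /gcontr !big_nil scaler0 addr0.
  exists [:: (1, s)]; rewrite lc1; split => // X u _.
  by rewrite lc1 /gcontr big_nil addr0.
- have [lf _] := field_op_bounded Fk h.
  split => // [X u c x y|s].
    by rewrite /gcontr !big_seq1/= linBr scalerDr !scalerA mulrC.
  pose h' : rL2 R := exist _ h hr.
  pose l0 : seq (R[i] * I) := if s is g :: s' then [:: (inner_L2half (sval g) h, s')] else [::].
  exists ((1, h' :: s) :: l0); split.
    rewrite [LHS](field_op_ev Fk h') /lc big_cons/= scale1r; congr (_ + _).
    by rewrite /l0; case: s {l0} => [|g s']; rewrite ?big_nil ?big_seq1.
  move=> X u lX; have := dsplit_field h' s u lX.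
  rewrite /gcontr big_seq1/= => ->.
  rewrite /lc big_cons/= scale1r; congr (_ + _).
  by rewrite /l0; case: s {l0} => [|g s']; rewrite ?big_nil ?big_seq1.
- split => [k x y|X u k x y|s].
  + by rewrite lA scalerDr !scalerA mulrC.
  + have h z : gcontr X [seq (v.1.1, (fun x => c *: v.1.2 x), v.2) | v <- a] u z =
        gcontr (X \o (fun x => c *: x)) a u z by rewrite /gcontr big_map.
    by rewrite !h la.
  + have [l [hl el]] := rA s.
    exists (lscale c l); rewrite lc_scale -hl; split => // X u lX.
    by rewrite lc_scale -el// dsplit_comp// gcontr_scale// scalerDr.
- split => [k x y|X u k x y|s].
  + by rewrite /= lA lB scalerDr addrACA.
  + by rewrite !gcontr_cat la lb scalerDr addrACA.
  + have [l [hl el]] := rA s; have [l' [hl' el']] := rB s.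
    exists (l ++ l'); rewrite lc_cat -hl -hl'; split => // X u lX.
    by rewrite lc_cat -el// -el'// dsplitD// gcontr_cat addrACA.
- split => [k x y|X u k x y|s].
  + by rewrite /= lB lA.
  + rewrite !gcontr_cat !gcontr_left !gcontr_right lB la lb.
    by rewrite scalerDr addrACA.
  (* B (ev s) is expanded into words, and the property of [A] is then used at each of them: this is
     where arbitrary words in place of the vacuum are needed. The terms of [b] are handled by the
     property of [B] with multiplier [X \o A]. *)
  + have [l [hl el]] := rB s.
    have [k [hk ek]] := grad_rel_lc l rA.
    exists k; split.
      by rewrite -hk /= hl (linear_lc _ _ lA).
    move=> X u lX; rewrite -ek// gcontr_cat gcontr_left gcontr_right addrA.
    have lXA : linear (X \o A) by move=> c x y; rewrite /= lA lX.
    rewrite [dsplit _ s u + _](el (X \o A) u lXA) hl (linear_lc _ _ (la X u)).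
    rewrite /lc -big_split; apply: eq_bigr => p _ /=.
    by rewrite scalerDr.
Qed.

(** The empty word has no splits, so at the vacuum the invariant speaks of the gradient of [A]
    alone. *)
Lemma grad_alg_lc A a : grad_alg A a ->
  exists l, A vac = lc ev l /\
    forall X u, linear X -> gcontr X a u vac = lc (fun s => dsplit X s u) l.
Proof.
move=> /grad_alg_inv[lA la /(_ [::])[l [hl el]]].
exists l; split; first exact: hl.
move=> X u lX; rewrite -el//.
by rewrite /dsplit big_nil add0r.
Qed.

(** The recursion W(h t) = S(h) W(t) - (g, h) W(t') for t = g t'. It goes back to two shorter words,
    hence the induction on a bound for the length. *)
Lemma wick s : exists A a, [/\ grad_alg A a, A vac = ev s &
  forall X u, linear X -> gcontr X a u vac = dsplit X s u].
Proof.
have [n] := ubnP (size s); elim: n s => // n IH [_|h t /= ht].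
  exists idfun, [::]; split => //; first exact: grad_one.
  by move=> X u _; rewrite /gcontr /dsplit !big_nil.
have [A [a [gA hA ea]]] := IH t ht.
(* For empty [t] the coefficient is 0 and [behead t] is again empty, so the same operator expression
   serves both cases. *)
pose c : R[i] := if t is g :: _ then - inner_L2half (sval g) (sval h) else 0.
have ht' : (size (behead t) < n)%N.
  by rewrite size_behead (leq_ltn_trans (leq_pred _)).
have [A' [a' [gA' hA' ea']]] := IH (behead t) ht'.
have [lS _] := field_op_bounded Fk (sval h).
eexists; eexists; split.
- apply: grad_add; first exact: grad_mul (grad_field _ (proj2_sig h)) gA.
  exact: grad_scale c _ _ gA'.
- rewrite /= hA hA' field_op_ev /c -addrA; case: t {IH ht ht' A a gA hA ea A' a' gA' hA' ea' c} => [|g s'].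
    by rewrite scale0r !addr0.
  by rewrite scaleNr subrr addr0.
- move=> X u lX; rewrite !gcontr_cat gcontr_left gcontr_scale// gcontr_right ea ?ea'//.
    rewrite /gcontr big_seq1/= hA dsplit_field// -addrA /c.
    case: t {IH ht ht' A a gA hA ea A' a' gA' hA' ea' c} => [|g s'].
      by rewrite scale0r !addr0.
    by rewrite scaleNr subrr addr0.
  by move=> k x y; rewrite /= lS lX.
Qed.

Lemma wick_lc l : exists A a, [/\ grad_alg A a, A vac = lc ev l &
  forall X u, linear X -> gcontr X a u vac = lc (fun s => dsplit X s u) l].
Proof.
elim: l => [|[c s] l [A [a [gA hA ea]]]].
  eexists; eexists; split; first exact: grad_scale 0 _ _ (grad_one _).
    by rewrite /= scale0r lc_nil.
  by move=> X u lX; rewrite gcontr_scale// scale0r lc_nil.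
have [A' [a' [gA' hA' ea']]] := wick s.
eexists; eexists; split.
- exact: grad_add (grad_scale c gA') gA.
- by rewrite /= hA hA' [RHS]/lc big_cons.
- by move=> X u lX; rewrite gcontr_cat gcontr_scale// ea// ea'// [RHS]/lc big_cons.
Qed.

End GradAlgebra.

(** * Wigner integrals and the Ornstein-Uhlenbeck semigroup *)

(** Preservation of inner products spreads from the family to the closed span in one variable at a
    time; conjugate symmetry exchanges the variables. *)
Lemma isometry_inner (R : realType) (H K : hilbert R) (I : Type) (e : I -> H)
    (T : H -> K) (C : R) :
  linear T -> (forall x, nrm (T x) <= C * nrm x) -> (forall x, cspan e x) ->
  (forall i j, inner (T (e i)) (T (e j)) = inner (e i) (e j)) ->
  forall x y, inner (T x) (T y) = inner x y.
Proof.
move=> lT bT eT hT.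
have step y : (forall i, inner (T (e i)) (T y) = inner (e i) y) ->
    forall x, inner (T x) (T y) = inner x y.
  move=> hy x; apply/eqP; rewrite -subr_eq0; apply/eqP.
  apply: (@scalar_total0 _ _ _ e (fun x => inner (T x) (T y) - inner x y)
    (C * nrm (T y) + nrm y)) (eT x) => [a u v|{}x|i].
  - by rewrite lT !innerDl !innerZl; ring.
  - rewrite raddfB/= mulrDl.
    have h1 := Re_inner_le (T x) (T y); have := Re_inner_abs x y.
    rewrite ler_norml => /andP[h2 _]; have h3 := bT x.
    have h4 := ler_wpM2r (nrm_ge0 (T y)) h3.
    have h5 := le_trans h1 h4.
    rewrite lerD//; first by rewrite mulrAC.
    by rewrite lerNl mulrC.
  - by rewrite hy subrr.
move=> x y; apply: (step) => i.
rewrite [LHS]inner_conj [RHS]inner_conj; congr (conjc _).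
by apply: step => j; rewrite hT.
Qed.

Section L2SC.
Variables (R : realType) (Fk : full_fock R) (L : L2_SC Fk).

Notation vac := (vacuum Fk).
Notation I := (seq (rL2 R)).
Notation ev := (@ev R Fk).
Notation U := (@wigner_unitary R Fk L).

Lemma inner_L2incl_vac X Y : SC X -> SC Y ->
  inner (L2incl L X) (L2incl L Y) = inner (X vac) (Y vac).
Proof.
move=> hX hY; rewrite inner_L2incl// /tau /=.
by rewrite inner_conj -(adjP (SC_bounded hY)) -inner_conj.
Qed.

(** X |-> X vac is isometric on the dense image of SC and extends. For surjectivity a right inverse
    [j] is built in the same way, sending each word to the class of an algebra element with that
    vacuum vector. *)
Lemma wigner_unitaryP : [/\ bounded_op U,
  (forall x y, inner (U x) (U y) = inner x y),
  (forall y, exists x, U x = y) & forall X, SC X -> U (L2incl L X) = X vac].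
Proof.
pose J := {X : Fk -> Fk | SC X}.
pose e (X : J) := L2incl L (sval X); pose b (X : J) := sval X vac.
have e_total x : cspan e x.
  move=> eps e0; have := dense_L2incl L => h.
  have /closure_nrmP/(_ _ e0)[_ [X hX <-] hx] : closure (L2incl L @` @SC R Fk) x by rewrite h.
  by exists [:: (1, exist _ X hX)]; rewrite lc1.
have he i j : inner (b i) (b j) = inner (e i) (e j).
  by rewrite inner_L2incl_vac//; [exact: (proj2_sig i)|exact: (proj2_sig j)].
have hl l : nrm (lc b l) <= 1 * nrm (lc e l).
  rewrite mul1r le_eqVlt; apply/orP; left; apply/eqP; apply: nrm_inner_eq.
  rewrite /lc !inner_suml; apply: eq_bigr => p _.
  rewrite !inner_sumr; apply: eq_bigr => q _.
  by rewrite !innerZl !innerZr he.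
have [T [lT bT eT]] := extension ler01 e_total hl.
have iT : forall x y, inner (T x) (T y) = inner x y.
  by apply: (isometry_inner lT bT e_total) => i j; rewrite !eT he.
have TX X : SC X -> T (L2incl L X) = X vac by move=> hX; rewrite (eT (exist _ X hX)).
have /boolp.choice[A hA] (s : I) : exists A, SC A /\ A vac = ev s.
  (* Only the operator produced by [wick] is wanted, so its gradient is evaluated with the zero
     form. *)
  have lin0 : forall y : Fk, linear (fun _ : Fk => 0 : R[i]^o).
    by move=> _ c x y; rewrite scaler0 addr0.
  have [A [a [gA hA _]]] := @wick R Fk R[i]^o (fun _ _ => 0) lin0 s.
  by exists A; split => //; exact: grad_alg_SC gA.
have hl' l : nrm (lc (fun s => L2incl L (A s)) l) <= 1 * nrm (lc ev l).
  rewrite mul1r le_eqVlt; apply/orP; left; apply/eqP; apply: nrm_inner_eq.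
  rewrite /lc !inner_suml; apply: eq_bigr => p _.
  rewrite !inner_sumr; apply: eq_bigr => q _.
  have [sp vp] := hA p.2; have [sq vq] := hA q.2.
  by rewrite !innerZl !innerZr inner_L2incl_vac// vp vq.
have [j [lj bj ej]] := extension ler01 (@ev_total R Fk) hl'.
have Tj y : T (j y) = y.
  apply: (@eq_total _ _ _ _ ev (T \o j) id 1 1) (ev_total y) => //.
  - by move=> c x z; rewrite /= lj lT.
  - move=> x; rewrite mul1r; have := bT (j x); rewrite mul1r => /le_trans; apply.
    by have := bj x; rewrite mul1r.
  - by move=> x; rewrite mul1r.
  - by move=> s; rewrite /= ej; have [sA vA] := hA s; rewrite TX.
apply: (getPex (P := [set U : L -> Fk | [/\ bounded_op U,
         (forall x y, inner (U x) (U y) = inner x y),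
         (forall y, exists x, U x = y) &
         forall X, SC X -> U (L2incl L X) = X (vacuum Fk)]])).
exists T; split => //.
  by split=> //; apply/(bounded_op_nrm lT); exists 1 => //; exact: ler01.
by move=> y; exists (j y).
Qed.

Lemma wigner_unitary_linear : linear U.
Proof. by have [[]] := wigner_unitaryP. Qed.

Lemma wigner_unitary_inner x y : inner (U x) (U y) = inner x y.
Proof. by have [] := wigner_unitaryP. Qed.

Lemma nrm_wigner_unitary x : nrm (U x) = nrm x.
Proof. by apply: nrm_inner_eq; exact: wigner_unitary_inner. Qed.

Lemma wigner_unitary_inj : injective U.
Proof.
move=> x y h; apply/eqP; rewrite -subr_eq0; apply/eqP; apply: nrm_eq0.
by rewrite -nrm_wigner_unitary (linearP_B wigner_unitary_linear) h subrr nrm0.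
Qed.

Lemma wignerK f : U (wigner L f) = f.
Proof.
have [_ _ sU _] := wigner_unitaryP.
exact: (getPex (P := [set F | U F = f]) (sU f)).
Qed.

Lemma wigner_unitaryK F : wigner L (U F) = F.
Proof. by apply: wigner_unitary_inj; rewrite wignerK. Qed.

Lemma wigner_linear : linear (@wigner R Fk L).
Proof.
move=> c x y; apply: wigner_unitary_inj.
by rewrite wigner_unitary_linear !wignerK.
Qed.

Lemma nrm_wigner f : nrm (wigner L f) = nrm f.
Proof. by rewrite -nrm_wigner_unitary wignerK. Qed.

Lemma wigner_le f : nrm (wigner L f) <= 1 * nrm f.
Proof. by rewrite nrm_wigner mul1r. Qed.

Lemma inner_wigner f g : inner (wigner L f) (wigner L g) = inner f g.
Proof. by rewrite -wigner_unitary_inner !wignerK. Qed.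

Lemma L2incl_wigner X : SC X -> L2incl L X = wigner L (X vac).
Proof.
by move=> hX; apply: wigner_unitary_inj; rewrite wignerK; have [_ _ _ ->] := wigner_unitaryP.
Qed.

Definition wev (s : I) : L := wigner L (ev s).

Lemma wev_total F : cspan wev F.
Proof.
rewrite -[F]wigner_unitaryK; apply: (cspan_img wigner_linear wigner_le) (ev_total _).
move=> s; exact: (cspan_fam wev).
Qed.

Lemma wev_orth s s' : size s != size s' -> inner (wev s) (wev s') = 0.
Proof. by move=> h; rewrite inner_wigner ev_orth. Qed.

Lemma lc_wev l : lc wev l = wigner L (lc ev l).
Proof. by rewrite (linear_lc _ _ wigner_linear). Qed.

Notation J n := (proj wev size n).

Lemma fock_degree_proj n F : fock_degree n (U (J n F)).
Proof.
have [lJ bJ eJ] := multP wev_total wev_orth (@contr_proj R _ n).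
apply: (@cspan_closure _ _ _ (fun x : {s : I | size s = n} => ev (sval x))).
  by move=> [s hs]; exists (map sval s); rewrite size_map.
have lUJ : linear (U \o J n).
  by move=> c x y; rewrite /= /proj lJ wigner_unitary_linear.
apply: (cspan_img lUJ (C := 1)) (wev_total F) => [x|s].
  by rewrite /= nrm_wigner_unitary mul1r; exact: bJ.
rewrite /= /proj eJ (linearP_Z wigner_unitary_linear) wignerK.
have [hs|] := eqVneq (size s) n; last by rewrite scale0r => _; exact: cspan0.
rewrite scale1r.
exact: (cspan_fam (fun x : {s : I | size s = n} => ev (sval x)) (exist _ s hs)).
Qed.

Lemma proj_wigner m n f : fock_degree n f ->
  J m (wigner L f) = (n == m)%:R%:C *: wigner L f.
Proof.
move=> hf; have [lJ bJ eJ] := multP wev_total wev_orth (@contr_proj R _ m).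
have hf' : cspan (fun x : {s : I | size s = n} => ev (sval x)) f.
  have := closure_linspan (e := fun x : {s | size s = n} => etens Fk (sval x)) _ hf.
  have h a : [set x | exists s, size s = n /\ x = etens Fk s] a ->
      exists i : {s | size s = n}, a = etens Fk (sval i).
    by move=> [s [hs ->]]; exists (exist _ s hs).
  move=> /(_ h); apply: cspan_sub => -[s hs] /=.
  by have := @etens_cspan R Fk s; rewrite hs.
apply: (@eq_total _ _ _ _ _ (J m \o wigner L) (fun f => (n == m)%:R%:C *: wigner L f)
  1 1) hf' => [a x y|a x y|x|x|[s hs]].
- by rewrite /= wigner_linear /proj lJ.
- by rewrite wigner_linear scalerDr !scalerA mulrC.
- by rewrite /= mul1r (le_trans (bJ _))// nrm_wigner.
- rewrite nrmZ nrm_wigner normc_def/= expr0n/= addr0 sqrtr_sqr.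
  by rewrite ler_wpM2r ?nrm_ge0// ger0_norm ?ler0n// lern1 leq_b1.
- by rewrite /= [LHS]eJ hs.
Qed.

(** Existence of the chaos expansion is [mult_series] for the constant multiplier 1, whose operator
    is the identity. *)
Lemma chaosP F : (forall n, fock_degree n (chaos F n)) /\
  series (fun n => wigner L (chaos F n)) @ \oo --> F.
Proof.
apply: (getPex (P := [set f : nat -> Fk | (forall n, fock_degree n (f n)) /\
         series (fun n => wigner L (f n)) @ \oo --> F])).
exists (fun n => U (J n F)); split; first by move=> n; exact: fock_degree_proj.
have c1 : contractive (fun _ : nat => 1 : R) by move=> n; rewrite ler01 lexx.
have -> : (fun n => wigner L (U (J n F))) = (fun n => (1 : R)%:C *: J n F).
  by apply/funext => n; rewrite wigner_unitaryK scale1r.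
have {2}-> : F = mult wev size (fun=> 1) F.
  rewrite -(@mult_eq _ _ _ _ _ _ wev_total wev_orth (fun=> 1) id 1)//.
    by move=> x; rewrite mul1r.
  by move=> s; rewrite scale1r.
have h := mult_series wev_total wev_orth (F := F) c1.
exact: h.
Qed.

(** Uniqueness of the expansion: the projection is a contraction, and it sends every partial sum
    that contains the term of order [n] to that term. *)
Lemma wigner_chaos F n : wigner L (chaos F n) = J n F.
Proof.
have [hd hc] := chaosP F.
have [lJ bJ eJ] := multP wev_total wev_orth (@contr_proj R _ n).
apply/eqP; rewrite -subr_eq0; apply/eqP; apply: nrm_small => eps e0.
move/cvg_nrmP: hc => /(_ _ e0)[N _ hN].
(* Far enough both for the precision and for the partial sum to include index [n]. *)
have := hN (maxn N n.+1); rewrite /= leq_maxl => /(_ isT) h.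
rewrite -[X in X - _](_ : J n (series (fun k => wigner L (chaos F k)) (maxn N n.+1)) = _).
  by rewrite -(linearP_B lJ) (le_trans (bJ _))// ltW.
rewrite /series/= big_mkord /proj (linearP_sum lJ).
have nN : (n < maxn N n.+1)%N by rewrite leq_max leqnn orbT.
rewrite (bigD1 (Ordinal nN))//= big1 ?addr0.
  by rewrite [LHS](proj_wigner _ (hd n)) eqxx scale1r.
move=> i ni; rewrite [LHS](proj_wigner _ (hd i)).
by rewrite (_ : _ == n = false) ?scale0r//; apply: contraNF ni => /eqP h'; apply/eqP/val_inj.
Qed.

Definition ou_mult (t : R) (n : nat) : R := expR (- (n%:R * t)).

Lemma contr_ou t : 0 < t -> contractive (ou_mult t).
Proof.
move=> t0 n; rewrite /ou_mult expR_ge0/= -expR0 ler_expR oppr_le0.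
by rewrite mulr_ge0// ltW.
Qed.

Lemma OU_mult t F : 0 < t -> OU t F = mult wev size (ou_mult t) F.
Proof.
move=> t0; rewrite /OU; apply: cvg_lim; first exact: norm_hausdorff.
under [X in series X]eq_fun do rewrite wigner_chaos.
have h := mult_series wev_total wev_orth (F := F) (contr_ou t0).
exact: h.
Qed.

End L2SC.

(** * The tensor square *)

(** A congruence with the side condition carried by [all], since membership in [s] would need a
    decidable equality on [T]. *)
Lemma eq_big_all (T : Type) (V : nmodType) (P : pred T) (F G : T -> V) (s : seq T) :
  all P s -> (forall x, P x -> F x = G x) ->
  \sum_(x <- s) F x = \sum_(x <- s) G x.
Proof.
move=> + h; elim: s => [|x s IH] /=; first by rewrite !big_nil.
by move=> /andP[Px /IH Ps]; rewrite !big_cons Ps h.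
Qed.

Lemma size_splits (T : Type) (s : seq T) :
  all (fun x => size x.1.1 + (size x.2).+1 == size s)%N (splits s).
Proof.
elim: s => //= h s IH; rewrite add0n eqxx/= all_map.
by apply: sub_all IH => x /=; rewrite addSn eqSS.
Qed.

(** A split of a given word is determined by the length of its left part; this is why each word
    leaves at most one term in a bidegree. *)
Lemma filter_splits (T : Type) (p : seq T) h q :
  [seq x <- splits (p ++ h :: q) | size x.1.1 == size p] = [:: (p, h, q)].
Proof.
elim: p => [|g p IH] /=; rewrite filter_map.
  by rewrite (eq_filter (a2 := pred0)) ?filter_pred0.
rewrite (eq_filter (a2 := fun x => size x.1.1 == size p)).
  by rewrite IH.
by move=> x /=; rewrite eqSS.
Qed.

Section Tensor.
Variables (R : realType) (Fk : full_fock R) (L : L2_SC Fk) (LL : hilbert_tensor L L).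

Notation vac := (vacuum Fk).
Notation I := (seq (rL2 R)).
Notation ev := (@ev R Fk).
Notation wev := (@wev R Fk L).

Lemma tmul_total (z : LL) : cspan (fun p : L * L => tmul LL p.1 p.2) z.
Proof.
have := total_tmul LL; rewrite /total_set => h.
have : closure (linspan [set z | exists x y, z = tmul LL x y]) z by rewrite h.
by apply: closure_linspan => _ [x [y ->]]; exists (x, y).
Qed.

Lemma tmul_eq (z z' : LL) :
  (forall x y, inner z (tmul LL x y) = inner z' (tmul LL x y)) -> z = z'.
Proof.
move=> h; apply/eqP; rewrite -subr_eq0; apply/eqP.
apply: (inner_total0 (tmul_total _)) => p.
by rewrite innerDl innerNl h subrr.
Qed.

Lemma tmul_linearl y : linear (fun x => tmul LL x y).
Proof.
move=> c x x'; apply: tmul_eq => u v.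
by rewrite innerDl innerZl !inner_tmul innerDl innerZl; ring.
Qed.

Lemma tmul_linearr x : linear (tmul LL x).
Proof.
move=> c y y'; apply: tmul_eq => u v.
by rewrite innerDl innerZl !inner_tmul innerDl innerZl; ring.
Qed.

Lemma nrm_tmul x y : nrm (tmul LL x y) = nrm x * nrm y.
Proof.
have := inner_tmul LL x y x y; rewrite !inner_nrm -rmorphM -exprMn => /complexI /eqP.
by rewrite eqrXn2 ?mulr_ge0 ?nrm_ge0// => /eqP.
Qed.

Definition wtens (p : I * I) : LL := tmul LL (wev p.1) (wev p.2).
Definition bideg (p : I * I) := (size p.1, size p.2).

Lemma wtens_total z : cspan wtens z.
Proof.
apply: cspan_sub (tmul_total z) => -[x y] /=.
apply: (cspan_img (tmul_linearr x) (C := nrm x)) (wev_total y) => [v|s].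
  by rewrite nrm_tmul.
apply: (cspan_img (tmul_linearl (wev s)) (C := nrm (wev s))) (wev_total x) => [v|s'].
  by rewrite nrm_tmul mulrC.
exact: (cspan_fam wtens (s', s)).
Qed.

Lemma wtens_orth p q : bideg p != bideg q -> inner (wtens p) (wtens q) = 0.
Proof.
rewrite /wtens inner_tmul xpair_eqE negb_and.
by move=> /orP[] h; rewrite (wev_orth L h) ?mulr0 ?mul0r.
Qed.

Definition ou2_mult (t : R) (n : nat * nat) := ou_mult t (n.1 + n.2).

Lemma contr_ou2 t : 0 < t -> contractive (ou2_mult t).
Proof. by move=> t0 n; exact: contr_ou. Qed.

Definition OU2 t := mult wtens bideg (ou2_mult t).

Lemma OU2P t : 0 < t -> mult_spec wtens bideg (ou2_mult t) (OU2 t).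
Proof. by move=> t0; exact: (multP wtens_total wtens_orth (contr_ou2 t0)). Qed.

(** On words this is the multiplicativity of the exponential in the degree; density is used in one
    tensor factor after the other. *)
Lemma OU2_tmul t x y : 0 < t -> OU2 t (tmul LL x y) = tmul LL (OU t x) (OU t y).
Proof.
move=> t0; have [lQ bQ eQ] := OU2P t0; rewrite !OU_mult//.
have [lM bM eM] := multP (@wev_total _ _ L) (@wev_orth _ _ L) (contr_ou t0).
have step s : OU2 t (tmul LL x (wev s)) =
    tmul LL (mult wev size (ou_mult t) x) (mult wev size (ou_mult t) (wev s)).
  apply: (@eq_total _ _ _ _ wev (fun x => OU2 t (tmul LL x (wev s)))
    (fun x => tmul LL (mult wev size (ou_mult t) x) (mult wev size (ou_mult t) (wev s)))
    (nrm (wev s)) (nrm (mult wev size (ou_mult t) (wev s)))) (wev_total x).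
  - by move=> c u v; rewrite tmul_linearl lQ.
  - by move=> c u v; rewrite lM tmul_linearl.
  - by move=> u; rewrite (le_trans (bQ _))// nrm_tmul mulrC.
  - by move=> u; rewrite nrm_tmul mulrC ler_wpM2l ?nrm_ge0.
  - move=> s'; rewrite !eM -[tmul LL (wev s') _]/(wtens (s', s)) eQ.
    rewrite (linearP_Z (tmul_linearl _)) (linearP_Z (tmul_linearr _)) scalerA.
    congr (_ *: _); rewrite -rmorphM /ou2_mult /ou_mult/= -expRD natrD.
    by congr (expR _)%:C; ring.
apply: (@eq_total _ _ _ _ wev (fun y => OU2 t (tmul LL x y))
  (fun y => tmul LL (mult wev size (ou_mult t) x) (mult wev size (ou_mult t) y))
  (nrm x) (nrm (mult wev size (ou_mult t) x))) (wev_total y) => //.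
- by move=> c u v; rewrite tmul_linearr lQ.
- by move=> c u v; rewrite lM tmul_linearr.
- by move=> u; rewrite (le_trans (bQ _))// nrm_tmul.
- by move=> u; rewrite nrm_tmul ler_wpM2l ?nrm_ge0.
Qed.

Lemma tensor_opE t : 0 < t -> tensor_op (OU t) (OU t) = OU2 t.
Proof.
move=> t0; have [lQ bQ eQ] := OU2P t0.
have [[lP cP] eP] : [set Q : LL -> LL | bounded_op Q /\
     forall x y, Q (tmul LL x y) = tmul LL (OU t x) (OU t y)]
     (tensor_op (OU t) (OU t)).
  apply: getPex; exists (OU2 t); split; last by move=> x y; rewrite OU2_tmul.
  split=> //; apply/(bounded_op_nrm lQ); exists 1; first exact: ler01.
  by move=> x; rewrite mul1r.
have [C C0 bC] := (bounded_op_nrm lP).1 cP.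
apply/funext => z.
apply: (@eq_total _ _ _ _ _ _ (OU2 t) C 1) (tmul_total z) => // [x|p].
  by rewrite mul1r.
by rewrite eP OU2_tmul.
Qed.

(** The form to which the algebraic results on gradients are applied, the legs being given by their
    vacuum vectors. *)
Definition tmul_wigner (x y : Fk) : LL := tmul LL (wigner L x) (wigner L y).

Lemma tmul_wigner_linearl y : linear (tmul_wigner^~ y).
Proof. by move=> c x x'; rewrite /tmul_wigner wigner_linear tmul_linearl. Qed.

Lemma tmul_wigner_linearr x : linear (tmul_wigner x).
Proof. by move=> c y y'; rewrite /tmul_wigner wigner_linear tmul_linearr. Qed.

Notation D := (dsplit tmul_wigner idfun).

Lemma dsplit_wtens s u :
  D s u = \sum_(x <- splits s) sval x.1.2 u *: wtens (x.1.1, x.2).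
Proof. by []. Qed.

Lemma tmul_L2incl X Y : SC X -> SC Y ->
  tmul LL (L2incl L X) (L2incl L Y) = tmul_wigner (X vac) (Y vac).
Proof. by move=> hX hY; rewrite !L2incl_wigner. Qed.

(** [L2incl] is only controlled on SC, so all legs must lie there. The induction carries this
    through outer factors [X] and [Y] in SC, which absorb the operators that the scaling and product
    rules put on the legs. *)
Lemma grad_eval_gcontr A a u : grad_alg A a ->
  grad_eval LL a u = gcontr tmul_wigner idfun a u vac.
Proof.
move=> ga; have h X Y : SC X -> SC Y ->
    \sum_(v <- a) v.1.1 u *: tmul LL (L2incl L (X \o v.1.2)) (L2incl L (v.2 \o Y)) =
    \sum_(v <- a) v.1.1 u *: tmul_wigner (X (v.1.2 vac)) (v.2 (Y vac)).
  elim: ga X Y => {A a} [|h hr|c A a ga IH|A a B b ga IHa gb IHb|A a B b ga IHa gb IHb] X Y hX hY.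
  - by rewrite !big_nil.
  - by rewrite !big_seq1/= tmul_L2incl.
  - rewrite !big_map; apply: (IH (X \o (fun x => c *: x))) => //.
    by apply: SC_comp => //; exact: SC_scale (SC_id _).
  - by rewrite !big_cat/= IHa// IHb.
  - rewrite !big_cat !big_map/=.
    rewrite [X in X + _ = _](IHb (X \o A) Y)//; last first.
      by apply: SC_comp => //; exact: grad_alg_SC ga.
    rewrite [X in _ + X = _](IHa X (B \o Y))//.
    by apply: SC_comp => //; exact: grad_alg_SC gb.
exact: (h idfun idfun (SC_id _) (SC_id _)).
Qed.

Lemma grad_alg_chaos A a : grad_alg A a -> exists l,
  L2incl L A = lc wev l /\ forall u, grad_eval LL a u = lc (D^~ u) l.
Proof.
move=> ga; have [l [hA ea]] := grad_alg_lc tmul_wigner_linearl tmul_wigner_linearr ga.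
exists l; split=> [|u]; last by rewrite (grad_eval_gcontr u ga) ea.
by rewrite L2incl_wigner ?hA ?lc_wev//; exact: grad_alg_SC ga.
Qed.

Lemma chaos_grad_alg l : exists A a, [/\ grad_alg A a,
  L2incl L A = lc wev l & forall u, grad_eval LL a u = lc (D^~ u) l].
Proof.
have [A [a [ga hA ea]]] := wick_lc tmul_wigner_linearl l.
exists A, a; split => // [|u]; last by rewrite (grad_eval_gcontr u ga) ea.
by rewrite L2incl_wigner ?hA ?lc_wev//; exact: grad_alg_SC ga.
Qed.

Lemma OU2_dsplit t s u : 0 < t ->
  (expR (- t))%:C *: OU2 t (D s u) = (ou_mult t (size s))%:C *: D s u.
Proof.
move=> t0; have [lQ bQ eQ] := OU2P t0.
rewrite !dsplit_wtens (linearP_sum lQ) !scaler_sumr.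
apply: eq_big_all (size_splits s) _ => x /eqP hx.
rewrite (linearP_Z lQ) eQ !scalerA mulrAC; congr ((_ * _) *: _).
rewrite -rmorphM/= /ou2_mult /ou_mult/= -expRD -hx.
by rewrite addnS -natr1 natrD; congr (expR _)%:C; ring.
Qed.

(** P_t preserves the algebra: it suffices to reweight the coefficient of each Wick word by the
    exponential of its length. *)
Lemma grad_alg_OU t A a : 0 < t -> grad_alg A a -> exists A' a',
  [/\ grad_alg A' a', L2incl L A' = OU t (L2incl L A) &
   forall u, grad_eval LL a' u = (expR (- t))%:C *: OU2 t (grad_eval LL a u)].
Proof.
move=> t0 /grad_alg_chaos[l [hA ea]].
have [A' [a' [ga' hA' ea']]] :=
  chaos_grad_alg [seq ((ou_mult t (size p.2))%:C * p.1, p.2) | p <- l].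
exists A', a'; split => // [|u].
  rewrite hA hA' OU_mult//.
  have [lM bM eM] := multP (@wev_total _ _ L) (@wev_orth _ _ L) (contr_ou t0).
  rewrite (linear_lc _ _ lM) /lc big_map; apply: eq_bigr => p _ /=.
  by rewrite eM !scalerA mulrC.
have [lQ bQ eQ] := OU2P t0.
rewrite ea ea' (linear_lc _ _ lQ) /lc big_map scaler_sumr; apply: eq_bigr => p _ /=.
transitivity (p.1 *: ((expR (- t))%:C *: OU2 t (D p.2 u))).
  by rewrite OU2_dsplit// scalerA mulrC.
by rewrite !scalerA mulrC.
Qed.

Notation P n := (proj wtens bideg n).

Lemma bideg_projP n : mult_spec wtens bideg (fun b => (b == n)%:R) (P n).
Proof. exact: (multP wtens_total wtens_orth (@contr_proj R _ n)). Qed.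

Lemma proj_dsplit p q s u : P (p, q) (D s u) =
  \sum_(x <- splits s | (size x.1.1 == p) && (size x.2 == q))
     sval x.1.2 u *: wtens (x.1.1, x.2).
Proof.
have [lP bP eP] := bideg_projP (p, q).
rewrite dsplit_wtens (linearP_sum lP) [RHS]big_mkcond; apply: eq_bigr => x _ /=.
rewrite (linearP_Z lP) eP /bideg xpair_eqE; case: ifP => _; first by rewrite scale1r.
by rewrite scale0r scaler0.
Qed.

Lemma proj_dsplit_eq p h q u :
  P (size p, size q) (D (p ++ h :: q) u) = sval h u *: wtens (p, q).
Proof.
have hs : \sum_(x <- splits (p ++ h :: q) | (size x.1.1 == size p) && (size x.2 == size q))
      sval x.1.2 u *: wtens (x.1.1, x.2) =
    \sum_(x <- splits (p ++ h :: q) | size x.1.1 == size p)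
      sval x.1.2 u *: wtens (x.1.1, x.2).
  rewrite big_mkcond [RHS]big_mkcond/=.
  apply: eq_big_all (size_splits _) _ => x; rewrite size_cat /= => /eqP hx.
  case: eqP => //= h1; move: hx; rewrite h1 => /addnI[->]; by rewrite eqxx.
by rewrite proj_dsplit hs -big_filter filter_splits big_seq1.
Qed.

Lemma proj_dsplit_neq p q s u : size s != (p + q).+1 -> P (p, q) (D s u) = 0.
Proof.
move=> hs; rewrite proj_dsplit big_mkcond.
rewrite (eq_big_all (G := fun _ => 0) (size_splits s)) ?big1// => x /eqP hx.
case: andP => // -[/eqP h1 /eqP h2].
by move: hs; rewrite -hx h1 h2 addnS eqxx.
Qed.

Definition glue (x : I * rL2 R * I) : I := x.1.1 ++ x.1.2 :: x.2.

Lemma glueP p q s : size s = (p + q).+1 ->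
  exists x, [/\ s = glue x, size x.1.1 = p & size x.2 = q].
Proof.
move=> hs; have := cat_take_drop p s.
have hp : size (take p s) = p by rewrite size_takel// hs leqW// leq_addr.
have hd : size (drop p s) = q.+1 by rewrite size_drop hs -addnS addKn.
case: (drop p s) hd => // h t [ht] {1}<-.
by exists (take p s, h, t).
Qed.

(** The words of length p + q + 1 are kept and cut after [p] letters. The bidegree part of the
    gradient and the chaos of order p + q + 1 are thus indexed by the same list with the same
    coefficients, ready for a comparison of norms. *)
Lemma proj_triples p q l : exists l' : seq (R[i] * (I * rL2 R * I)),
  [/\ all (fun y => (size y.2.1.1 == p) && (size y.2.2 == q)) l',
   forall u, P (p, q) (lc (D^~ u) l) =
     lc (fun x : I * rL2 R * I => sval x.1.2 u *: wtens (x.1.1, x.2)) l' &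
   proj wev size (p + q).+1 (lc wev l) = lc (fun x => wev (glue x)) l'].
Proof.
have [lP bP eP] := bideg_projP (p, q).
have [lJ bJ eJ] := multP (@wev_total _ _ L) (@wev_orth _ _ L) (@contr_proj R _ (p + q).+1).
elim: l => [|[c s] l [l' [h1 h2 h3]]].
  by exists [::]; split => // [u|]; rewrite !lc_nil ?(linearP_0 lP) ?[LHS](linearP_0 lJ).
have [hs|hs] := eqVneq (size s) (p + q).+1; last first.
  exists l'; split => // [u|].
    by rewrite {1}/lc big_cons lP proj_dsplit_neq// scaler0 add0r h2.
  rewrite {1}/lc big_cons /proj lJ eJ (negbTE hs) scale0r scaler0 add0r.
  exact: h3.
have [x [sx xp xq]] := glueP hs.
exists ((c, x) :: l'); split; first by rewrite /= xp xq !eqxx.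
  move=> u; rewrite {1}/lc big_cons lP h2 [RHS]/lc big_cons/=; congr (_ *: _ + _).
  by rewrite sx -xp -xq proj_dsplit_eq.
rewrite {1}/lc big_cons /proj lJ eJ hs eqxx scale1r [RHS]/lc big_cons/= -sx.
by congr (_ + _); exact: h3.
Qed.

(** Inner products of words factor position by position; equal left lengths put the two
    distinguished letters at the same position. If the right lengths differ, both sides vanish. *)
Lemma inner_ev_glue x y : size x.1.1 = size y.1.1 ->
  inner (wev (glue x)) (wev (glue y)) =
  inner_L2half (sval x.1.2) (sval y.1.2) *
  inner (wtens (x.1.1, x.2)) (wtens (y.1.1, y.2)).
Proof.
rewrite /wtens inner_tmul !inner_wigner /glue.
case: x y => [[p h] q] [[p' h'] q'] /=.
elim: p p' => [|g p IH] [|g' p'] //=.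
  have -> : inner (ev [::]) (ev [::]) = 1 by rewrite inner_etens/= big_nil.
  by rewrite mul1r => _; rewrite [LHS]inner_etens_cons.
move=> [/IH hp]; rewrite [LHS]inner_etens_cons [inner (ev (g :: p)) _]inner_etens_cons.
by rewrite -/(ev _) hp; ring.
Qed.

End Tensor.

(** * Square-integrable vector-valued functions *)

Section FiniteRange.
Variable R : realType.

(** [simple_fun] for any codomain, in particular for pairs: sums of simple functions become
    compositions, with no sigma-algebra on the values. *)
Definition finite_measurable (T : Type) (g : R -> T) : Prop :=
  finite_set (range g) /\ forall v, measurable (g @^-1` [set v]).

Lemma finite_measurable_preimage (T : Type) (g : R -> T) (Y : set T) :
  finite_measurable g -> measurable (g @^-1` Y).
Proof.
move=> [fg mg].
have -> : g @^-1` Y = \bigcup_(v in range g `&` Y) g @^-1` [set v].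
  apply/seteqP; split => [s Ys|s [v [_ Yv] /= ->]//].
  by exists (g s) => //; split => //; exists s.
apply: fin_bigcup_measurable => [|v _]; last exact: mg.
exact: finite_setIl.
Qed.

Lemma finite_measurable_comp (T T' : Type) (g : R -> T) (phi : T -> T') :
  finite_measurable g -> finite_measurable (phi \o g).
Proof.
move=> hg; split; last by move=> v; rewrite comp_preimage; exact: finite_measurable_preimage.
rewrite (_ : range _ = phi @` range g); last by rewrite image_comp.
by apply: finite_image; case: hg.
Qed.

Lemma finite_measurable_pair (T T' : Type) (g : R -> T) (g' : R -> T') :
  finite_measurable g -> finite_measurable g' ->
  finite_measurable (fun s => (g s, g' s)).
Proof.
move=> [fg mg] [fg' mg']; split.
  apply: (@sub_finite_set _ _ (range g `*` range g')); last exact: finite_setX.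
  by move=> _ [s _ <-]; split; exists s.
move=> [v w]; have -> : (fun s => (g s, g' s)) @^-1` [set (v, w)] =
    g @^-1` [set v] `&` g' @^-1` [set w].
  by apply/seteqP; split=> s /= => [[-> ->]|[-> ->]].
exact: measurableI.
Qed.

End FiniteRange.

Section Bochner.
Variables (R : realType) (Fk : full_fock R) (L : L2_SC Fk) (LL : hilbert_tensor L L).
Implicit Types G : R -> LL.
Notation mu := (@lebesgue_half R).

Lemma cvg_nrm (u : nat -> LL) (x : LL) :
  u @ \oo --> x -> (fun n => nrm (u n)) @ \oo --> nrm x.
Proof.
move=> /cvg_nrmP h; apply/cvgrPdist_lt => e /h; apply: filterS => n.
apply: le_lt_trans; rewrite ler_norml lerBlDr lerNl opprB lerBlDr.
by rewrite (le_trans _ (nrmD _ _)) ?subrK// nrmBC (le_trans _ (nrmD _ _)) ?subrK.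
Qed.

Lemma measurable_nrm G : strongly_measurable G ->
  @measurable_fun _ _ (measurableTypeR R) _ setT (fun s => nrm (G s)).
Proof.
move=> [g sg cg].
apply: (measurable_fun_cvg (T := measurableTypeR R) (h := fun k s => nrm (g k s))) => [k|s _].
  move=> _ Y mY; rewrite setTI.
  have := @finite_measurable_preimage _ _ (@nrm R LL \o g k) Y.
  by apply; apply: finite_measurable_comp; exact: sg.
exact: cvg_nrm.
Qed.

Lemma strongly_measurableD G G' : strongly_measurable G ->
  strongly_measurable G' -> strongly_measurable (fun s => G s + G' s).
Proof.
move=> [g sg cg] [g' sg' cg']; exists (fun k s => g k s + g' k s) => [k|s].
  exact: (finite_measurable_comp (fun p : LL * LL => p.1 + p.2)
    (finite_measurable_pair (sg k) (sg' k))).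
by apply: cvgD.
Qed.

Lemma strongly_measurable_op G (T : LL -> LL) : strongly_measurable G ->
  continuous T -> strongly_measurable (fun s => T (G s)).
Proof.
move=> [g sg cg] cT; exists (fun k s => T (g k s)) => [k|s].
  exact: (finite_measurable_comp T (sg k)).
exact: (continuous_cvg _ (cT _) (cg s)).
Qed.

Lemma strongly_measurableZ c G : strongly_measurable G ->
  strongly_measurable (fun s => c *: G s).
Proof.
move=> hG; apply: (strongly_measurable_op (T := fun x => c *: x)) => // x.
by apply: cvgZr; exact: cvg_id.
Qed.

Lemma strongly_measurable_real (h : R -> R) (v : LL) :
  @measurable_fun _ _ (measurableTypeR R) R setT h ->
  strongly_measurable (fun s => (h s)%:C *: v).
Proof.
move=> mh; have mh' : @measurable_fun _ _ (measurableTypeR R) (\bar R) setT (EFin \o h).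
  exact/measurable_EFinP.
have [g hg] := approximation_sfun (@measurableT _ (measurableTypeR R)) mh'.
exists (fun k s => (g k s)%:C *: v) => [k|s].
  have : finite_measurable (g k : R -> R).
    split; first exact: (@fimfunP _ _ (g k)).
    by move=> r; have := @measurable_funPTI _ _ _ _ (g k) [set r]; apply; exact: measurable_set1.
  exact: (finite_measurable_comp (fun r => r%:C *: v)).
apply/cvg_nrmP => e e0; have D0 : 0 < nrm v + 1 by rewrite ltr_wpDl ?nrm_ge0.
have /cvgrPdist_lt/(_ _ (divr_gt0 e0 D0)) : (fun k => g k s) @ \oo --> h s.
  by have /fine_cvgP[] := hg s Logic.I.
apply: filterS => n hn; rewrite -scalerBl -rmorphB nrmZ normc_def/= expr0n/= addr0 sqrtr_sqr.
rewrite distrC in hn; rewrite ltr_pdivlMr// in hn; apply: le_lt_trans hn.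
by rewrite ler_wpM2l// lerDl.
Qed.

Lemma strongly_measurable_L2 (h : L2half R) (v : LL) :
  strongly_measurable (fun s => h s *: v).
Proof.
have -> : (fun s => h s *: v) = (fun s => (complex.Re (h s))%:C *: v +
    (complex.Im (h s))%:C *: ('i *: v)).
  by apply/funext => s; rewrite scalerA -scalerDl mulrC -complexE.
have [hr hi] := L2halfP h.
by apply: strongly_measurableD; apply: strongly_measurable_real;
  [move: hr|move: hi]; rewrite inE => /andP[]; rewrite inE.
Qed.

Lemma strongly_measurable_grad_eval a : strongly_measurable (grad_eval LL a).
Proof.
rewrite /grad_eval; elim: a => [|x a IH].
  exists (fun _ _ => 0) => [k|s]; last by rewrite big_nil; exact: cvg_cst.
  split; first by apply: (sub_finite_set (B := [set 0])) => // _ [s _ <-].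
  move=> v; have [->|v0] := pselect (v = 0).
    by rewrite (_ : _ @^-1` _ = setT)//; apply/seteqP; split.
  by rewrite (_ : _ @^-1` _ = set0)//; apply/seteqP; split => // s /= /esym.
under eq_fun do rewrite big_cons.
by apply: strongly_measurableD => //; exact: strongly_measurable_L2.
Qed.

Lemma strongly_measurableB G G' : strongly_measurable G ->
  strongly_measurable G' -> strongly_measurable (fun s => G s - G' s).
Proof.
move=> hG hG'; under eq_fun do rewrite -scaleN1r.
by apply: strongly_measurableD => //; exact: strongly_measurableZ.
Qed.

Lemma measurable_sqnrm G : strongly_measurable G ->
  @measurable_fun _ _ (measurableTypeR R) (\bar R) setT (fun s => ((nrm (G s)) ^+ 2)%:E).
Proof.
by move=> hG; apply/measurable_EFinP; apply: measurable_funX; exact: measurable_nrm.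
Qed.

Lemma sqnormB2_le G G' : strongly_measurable G -> strongly_measurable G' ->
  (forall s, nrm (G s) <= nrm (G' s)) -> (sqnormB2 G <= sqnormB2 G')%E.
Proof.
move=> mG mG' h; apply: ge0_le_integral => //.
- by move=> s _; rewrite lee_fin sqr_ge0.
- exact: measurable_sqnrm.
- exact: measurable_sqnrm.
- by move=> s _; rewrite lee_fin -!/(nrm _) ler_pXn2r ?nnegrE ?nrm_ge0.
Qed.

Lemma sqnormB2_ge0 G : (0 <= sqnormB2 G)%E.
Proof. by apply: integral_ge0 => s _; rewrite lee_fin sqr_ge0. Qed.

(** The pointwise bound |x + y|^2 <= 2 |x|^2 + 2 |y|^2 is integrated; the loss of a constant does
    not matter in limits. *)
Lemma sqnormB2D G G' : strongly_measurable G -> strongly_measurable G' ->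
  (sqnormB2 (fun s => (G s + G' s)%R) <= 2%:E * sqnormB2 G + 2%:E * sqnormB2 G')%E.
Proof.
move=> mG mG'; rewrite /sqnormB2.
rewrite -!ge0_integralZl//; last 4 first.
- exact: measurable_sqnrm.
- by move=> s _; rewrite lee_fin sqr_ge0.
- exact: measurable_sqnrm.
- by move=> s _; rewrite lee_fin sqr_ge0.
rewrite -ge0_integralD//; last 4 first.
- by move=> s _; rewrite -EFinM lee_fin mulr_ge0// sqr_ge0.
- by apply: measurable_funeM; exact: measurable_sqnrm.
- by move=> s _; rewrite -EFinM lee_fin mulr_ge0// sqr_ge0.
- by apply: measurable_funeM; exact: measurable_sqnrm.
apply: ge0_le_integral => //.
- by move=> s _; rewrite lee_fin sqr_ge0.
- by apply: measurable_sqnrm; exact: strongly_measurableD.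
- by apply: emeasurable_funD; apply: measurable_funeM; exact: measurable_sqnrm.
- move=> s _; rewrite -!EFinM -EFinD lee_fin.
  rewrite -!/(nrm _) nrmD_sqr; have := Re_inner_le (G s) (G' s).
  move: (nrm (G s)) (nrm (G' s)) (complex.Re _) => X Y z.
  by have := sqr_ge0 (X - Y); rewrite !expr2; nra.
Qed.

Lemma sqnormB2_eq0 G : strongly_measurable G -> sqnormB2 G = 0%E ->
  {ae mu, forall s, G s = 0}.
Proof.
move=> mG h0; have /ae_eq_integral_abs := measurable_sqnrm mG.
move=> /(_ mu (@measurableT _ _))[+ _].
under eq_integral do rewrite gee0_abs ?lee_fin ?sqr_ge0//.
move=> /(_ h0); apply: filterS => s /= /(_ Logic.I)[] /eqP.
by rewrite sqrf_eq0 => /eqP /nrm_eq0.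
Qed.

End Bochner.

(** * Closability and commutation *)

Section Closability.
Variables (R : realType) (Fk : full_fock R) (L : L2_SC Fk) (LL : hilbert_tensor L L).
Implicit Types G : R -> LL.
Notation mu := (@lebesgue_half R).
Notation I := (seq (rL2 R)).
Notation wev := (@wev R Fk L).
Notation wtens := (@wtens R Fk L LL).
Notation bideg := (@bideg R).
Notation P n := (proj wtens bideg n).

Lemma Re_sum (T : Type) (s : seq T) (F : T -> R[i]) :
  complex.Re (\sum_(x <- s) F x) = \sum_(x <- s) complex.Re (F x).
Proof. by apply: (big_morph (@complex.Re R)) => // -[a b] []. Qed.

Lemma nrm_lc_sqr (H : hilbert R) (T : Type) (e : T -> H) l :
  nrm (lc e l) ^+ 2 = \sum_(x <- l) \sum_(y <- l)
    complex.Re (x.1 * conjc y.1 * inner (e x.2) (e y.2)).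
Proof.
have -> : nrm (lc e l) ^+ 2 = complex.Re (inner (lc e l) (lc e l)).
  by rewrite inner_nrm.
rewrite {1}/lc inner_suml Re_sum; apply: eq_bigr => x _.
rewrite inner_sumr Re_sum; apply: eq_bigr => y _.
by rewrite innerZl innerZr mulrA.
Qed.

(* Since [p] and [q] are fixed, the factors of [glue x] and [glue y] are paired as
   in the integrals over time and in the inner products of the two legs. *)
Lemma sqnormB2_terms p q (l : seq (R[i] * (I * rL2 R * I))) :
  all (fun y => (size y.2.1.1 == p) && (size y.2.2 == q)) l ->
  sqnormB2 (fun u => lc (fun x : I * rL2 R * I =>
    sval x.1.2 u *: wtens (x.1.1, x.2)) l) =
  (nrm (lc (fun x => wev (glue x)) l) ^+ 2)%:E.
Proof.
move=> hl.
(* [K x y] collects what does not depend on time. The letters being real, the rest of each pair is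
   the real product f x * f y, which can be integrated termwise. *)
pose K (x y : R[i] * (I * rL2 R * I)) : R := complex.Re
  (x.1 * conjc y.1 * inner (wtens (x.2.1.1, x.2.2)) (wtens (y.2.1.1, y.2.2))).
pose f (x : R[i] * (I * rL2 R * I)) (u : R) : R := complex.Re (sval x.2.1.2 u).
have fL x : f x \in Lfun mu 2%:E by have [] := L2halfP (sval x.2.1.2).
have fE (x : R[i] * (I * rL2 R * I)) u : sval x.2.1.2 u = (f x u)%:C.
  rewrite /f; have := proj2_sig x.2.1.2 u.
  by case: (sval x.2.1.2 u) => a b /= ->.
have ii x y : mu.-integrable setT (EFin \o (fun u => f x u * f y u)).
  exact: integrable_mul2.
have ik x y : mu.-integrable setT (fun u => (f x u * f y u)%:E * (K x y)%:E)%E.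
  exact: integrableZr (K x y) _ (ii x y).
have e1 u : ((complex.Re `|lc (fun x : I * rL2 R * I =>
      sval x.1.2 u *: wtens (x.1.1, x.2)) l|) ^+ 2)%:E =
    (\sum_(x <- l) \sum_(y <- l) (f x u * f y u)%:E * (K x y)%:E)%E.
  rewrite -/(nrm _) nrm_lc_sqr -sumEFin; apply: eq_bigr => x _.
  rewrite -sumEFin; apply: eq_bigr => y _; rewrite -EFinM; congr EFin.
  rewrite !fE innerZl innerZr /K.
  by case: (x.1) (y.1) (inner _ _) => [a b] [c d] [g h] /=; ring.
rewrite /sqnormB2; under eq_integral do rewrite e1.
rewrite integral_sum//; last first.
  by move=> x; apply: integrable_sum => // y _; exact: ik.
rewrite nrm_lc_sqr -sumEFin; apply: (eq_big_all (hl)) => x /andP[/eqP xp /eqP xq].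
rewrite integral_sum//.
rewrite -sumEFin; apply: (eq_big_all (hl)) => y /andP[/eqP yp /eqP yq].
rewrite integralZr//; last exact: ii.
rewrite (inner_ev_glue LL); last by rewrite xp yp.
rewrite inner_L2half_real; [|exact: proj2_sig|exact: proj2_sig].
have -> : (\int[mu]_u (f x u * f y u)%:E)%E =
    (\int[mu]_u (f x u * f y u))%:E.
  by rewrite fineK//; exact: integrable_fin_num (ii x y).
rewrite -EFinM; congr EFin; rewrite /K.
case: (x.1) (y.1) (inner _ _) => [a b] [c d] [g h] /=.
by move: (\int[_]_ _ _) => z; ring.
Qed.

Lemma sqnormB2_proj_grad n A a : grad_alg A a ->
  (sqnormB2 (fun u => P n (grad_eval LL a u)) <=
   (nrm (L2incl L A) ^+ 2)%:E)%E.
Proof.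
case: n => p q ga; have [l [hA ea]] := grad_alg_chaos LL ga.
have [l' [hl h2 h3]] := proj_triples LL p q l.
under [X in sqnormB2 X]eq_fun do rewrite ea h2.
rewrite (sqnormB2_terms hl) -h3 hA lee_fin.
have [lJ bJ eJ] := multP (@wev_total _ _ L) (@wev_orth _ _ L) (@contr_proj R _ (p + q).+1).
by rewrite ler_pXn2r ?nnegrE ?nrm_ge0//; exact: bJ.
Qed.

Lemma cvge0_near (T : Type) (F : set_system T) {FF : Filter F} (u : T -> \bar R) :
  u @ F --> 0%E -> forall eps : R, 0 < eps -> \forall n \near F, (u n < eps%:E)%E.
Proof.
move=> /fine_cvgP[ufin /cvgrPdist_lt h] eps e0.
apply: filterS2 ufin (h _ e0) => n un; rewrite sub0r normrN => hn.
by rewrite -(fineK un) lte_fin (le_lt_trans (ler_norm _) hn).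
Qed.


Lemma continuous_proj n : continuous (P n).
Proof.
have [lP bP eP] := bideg_projP LL n; apply/(bounded_op_nrm lP).
by exists 1 => [|x]; [exact: ler01|rewrite mul1r; exact: bP].
Qed.

(** In each bidegree, G - G' is compared with the gradient of A_k - B_k, whose part there is bounded
    by the norm of A_k - B_k, and this tends to 0. *)
Lemma grad_closure_uniq F G G' : grad_closure F G -> grad_closure F G' ->
  {ae mu, forall s, G s = G' s}.
Proof.
move=> [[mG _] [A [a [ga cA ca]]]] [[mG' _] [B [b [gb cB cb]]]].
have hn n : {ae mu, forall s, P n (G s - G' s) = 0}.
  have [lP bP eP] := bideg_projP LL n; have cP := @continuous_proj n.
  have mGG : strongly_measurable (fun s => P n (G s - G' s)).
    by apply: strongly_measurable_op => //; exact: strongly_measurableB.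
  apply: sqnormB2_eq0 => //.
  apply/eqP; rewrite eq_le sqnormB2_ge0 andbT; apply/lee_addgt0Pr => eps e0.
  rewrite add0e.
  (* Two applications of [sqnormB2D] give 2 + 2 (2 + 2) = 10 pieces of this size. *)
  have e1 : 0 < eps / 12 by rewrite divr_gt0.
  (* With r this minimum, the difference of the approximants has norm at most 2r, and (2r)^2 <= 4r
     <= eps / 12 because r <= 1. *)
  have e2 : 0 < Num.min 1 (eps / 48) by rewrite lt_min ltr01 divr_gt0.
  have hA := (cvg_nrmP _ _).1 cA _ e2; have hB := (cvg_nrmP _ _).1 cB _ e2.
  near \oo => k.
  have ha : (sqnormB2 (fun s => (grad_eval LL (a k) s - G s)%R) < (eps / 12)%:E)%E.
    by near: k; exact: cvge0_near ca _ e1.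
  have hb : (sqnormB2 (fun s => (grad_eval LL (b k) s - G' s)%R) < (eps / 12)%:E)%E.
    by near: k; exact: cvge0_near cb _ e1.
  have hA' : nrm (L2incl L (A k) - F) < Num.min 1 (eps / 48) by near: k.
  have hB' : nrm (L2incl L (B k) - F) < Num.min 1 (eps / 48) by near: k.
  have gd := grad_add (ga k) (grad_scale (-1) (gb k)).
  set d := (X in grad_alg _ X) in gd; set D := (X in grad_alg X _) in gd.
  have dE s : grad_eval LL d s = grad_eval LL (a k) s - grad_eval LL (b k) s.
    rewrite (grad_eval_gcontr _ _ gd) (grad_eval_gcontr _ _ (ga k)).
    rewrite (grad_eval_gcontr _ _ (gb k)) /d gcontr_cat gcontr_scale ?scaleN1r//.
    exact: tmul_wigner_linearl.
  have DE : L2incl L D = L2incl L (A k) - L2incl L (B k).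
    rewrite (L2incl_wigner L (grad_alg_SC gd)) (L2incl_wigner L (grad_alg_SC (ga k))).
    rewrite (L2incl_wigner L (grad_alg_SC (gb k))).
    by rewrite /D /= scaleN1r (linearP_B (wigner_linear L)).
  have hD : nrm (L2incl L D) ^+ 2 <= eps / 12.
    have : nrm (L2incl L D) <= nrm (L2incl L (A k) - F) + nrm (L2incl L (B k) - F).
      by rewrite DE -(subrKA F) (le_trans (nrmD _ _))// lerD2l nrmBC.
    have := nrm_ge0 (L2incl L D); move: hA' hB'; rewrite !lt_min.
    move: (nrm _) (nrm _) (nrm _) => x y z /andP[x1 x2] /andP[y1 y2] z0 zxy.
    by nra.
  have mga c : strongly_measurable (fun s => P n (grad_eval LL c s)).
    by apply: strongly_measurable_op => //; exact: strongly_measurable_grad_eval.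
  have mPB G1 G2 : strongly_measurable G1 -> strongly_measurable G2 ->
      strongly_measurable (fun s => P n (G1 s - G2 s)).
    by move=> m1 m2; apply: strongly_measurable_op => //; exact: strongly_measurableB.
  have m1 := mPB _ _ mG (strongly_measurable_grad_eval LL (a k)).
  have m2 := mPB _ _ (strongly_measurable_grad_eval LL (b k)) mG'.
  have -> : (fun s => P n (G s - G' s)) = (fun s => P n (grad_eval LL d s) +
      (P n (G s - grad_eval LL (a k) s) + P n (grad_eval LL (b k) s - G' s))).
    apply/funext => s; rewrite dE -!(linearP_D lP); congr (P n _).
    by rewrite addrA [_ - _ + (_ - _)]addrC subrKA subrKA.
  have h1 := sqnormB2D (mga d) (strongly_measurableD m1 m2).
  have h2 := sqnormB2D m1 m2.
  have ha' : (sqnormB2 (fun s => P n (G s - grad_eval LL (a k) s)%R) <= (eps / 12)%:E)%E.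
    apply: le_trans (ltW ha); apply: sqnormB2_le => //.
      by apply: strongly_measurableB => //; exact: strongly_measurable_grad_eval.
    by move=> s; rewrite (le_trans (bP _))// nrmBC.
  have hb' : (sqnormB2 (fun s => P n (grad_eval LL (b k) s - G' s)%R) <= (eps / 12)%:E)%E.
    apply: le_trans (ltW hb); apply: sqnormB2_le => //.
    by apply: strongly_measurableB => //; exact: strongly_measurable_grad_eval.
  have hd' : (sqnormB2 (fun s => P n (grad_eval LL d s)) <= (eps / 12)%:E)%E.
    by apply: le_trans (sqnormB2_proj_grad n gd) _; rewrite lee_fin.
  have t2 : (0 <= 2%:E :> \bar R)%E by rewrite lee_fin.
  apply: le_trans h1 _.
  apply: le_trans (leeD (lee_wpmul2l t2 hd') (lee_wpmul2l t2 (le_trans h2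
    (leeD (lee_wpmul2l t2 ha') (lee_wpmul2l t2 hb'))))) _.
  by rewrite -!(EFinM, EFinD) lee_fin; lra.
(* There are countably many bidegrees, so one null set serves all of them. *)
have h0 : {ae mu, forall s, forall i j : nat, P (i, j) (G s - G' s) = 0}.
  by apply: ae_foralln => i; apply: ae_foralln => j; exact: hn.
have FF : Filter (almost_everywhere mu) := ae_filter_ringOfSetsType mu.
apply: (@filterS _ _ FF _ _ _ h0) => s hs.
apply/eqP; rewrite -subr_eq0; apply/eqP.
by apply: (proj_eq0 (@wtens_total _ _ _ LL) (@wtens_orth _ _ _ LL)) => -[i j]; exact: hs.
Unshelve. all: by end_near. Qed.

Lemma grad_closure_OU F G t : 0 < t -> grad_closure F G ->
  grad_closure (OU t F) (fun s => (expR (- t))%:C *: OU2 t (G s)).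
Proof.
move=> t0 [[mG fG] [A [a [ga cA ca]]]].
have [lQ bQ eQ] := OU2P LL t0.
have cQ : continuous (@OU2 _ _ _ LL t).
  apply/(bounded_op_nrm lQ).
  by exists 1 => [|x]; [exact: ler01|rewrite mul1r; exact: bQ].
have e1 : expR (- t) <= 1 by rewrite -expR0 ler_expR oppr_le0 ltW.
have bE x : nrm ((expR (- t))%:C *: OU2 t x) <= nrm (x : LL).
  rewrite nrmZ normc_def/= expr0n/= addr0 sqrtr_sqr ger0_norm ?expR_ge0//.
  by rewrite (le_trans _ (bQ x))// -[leRHS]mul1r ler_wpM2r ?nrm_ge0.
have mE G1 : strongly_measurable G1 ->
    strongly_measurable (fun s => (expR (- t))%:C *: OU2 t (G1 s)).
  by move=> m1; apply: strongly_measurableZ; exact: strongly_measurable_op.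
split.
  split; first exact: mE.
  by apply: le_lt_trans fG; apply: sqnormB2_le => //; exact: mE.
have /boolp.choice[Aa hA] k := grad_alg_OU LL t0 (ga k).
have {hA} /boolp.choice[a' hA] k := hA k.
exists Aa, a'; split.
- by move=> k; have [] := hA k.
- have [lM bM eM] := multP (@wev_total _ _ L) (@wev_orth _ _ L) (contr_ou t0).
  apply/cvg_nrmP => eps e0; apply: filterS ((cvg_nrmP _ _).1 cA _ e0) => k.
  have [_ -> _] := hA k; rewrite !OU_mult// -(linearP_B lM).
  exact: le_lt_trans (bM _).
- apply: (squeeze_cvge _ (cvg_cst _) ca); apply: nearW => k.
  rewrite sqnormB2_ge0/=; have [_ _ ea] := hA k.
  have -> : (fun s => grad_eval LL (a' k) s - (expR (- t))%:C *: OU2 t (G s)) =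
      (fun s => (expR (- t))%:C *: OU2 t (grad_eval LL (a k) s - G s)).
    by apply/funext => s; rewrite ea (linearP_B lQ) scalerBr.
  have mB : strongly_measurable (fun s => grad_eval LL (a k) s - G s).
    by apply: strongly_measurableB => //; exact: strongly_measurable_grad_eval.
  by apply: sqnormB2_le => //; exact: mE.
Qed.

End Closability.

Unset Implicit Arguments.

Theorem proposition12 (R : realType) (Fk : full_fock R) (L : L2_SC Fk)
    (LL : hilbert_tensor L L) (F : L) (t : R) :
  D12 LL F -> 0 < t ->
  D12 LL (OU t F) /\
  {ae lebesgue_half R, forall s,
     nabla LL (OU t F) s =
     (expR (- t))%:C *: tensor_op (OU t) (OU t) (nabla LL F s)}.
Proof.
move=> hF t0; have hG : grad_closure F (nabla LL F) by exact: (getPex hF).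
have hOU := grad_closure_OU t0 hG.
have dOU : D12 LL (OU t F) by eexists; exact: hOU.
split=> //; rewrite tensor_opE//.
(* [nabla] at [OU t F] is some chosen representative; uniqueness compares it with the one just
   constructed. *)
exact: grad_closure_uniq (getPex dOU) hOU.
Qed.
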